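(* Let $\Lambda$ be a Bara\'nski carpet, with associated numbers $\alpha=\alpha_1+\alpha_2$, $\beta=\beta_1+\beta_2$ and Bernoulli measures $\mu_A,\mu_B$ on $\Lambda$ as defined in the context. Then $$\mu=\begin{cases}\mu_A,&\text{if }\alpha>\beta;\\ \mu_B,&\text{if }\alpha<\beta;\\ \mu_A+\mu_B,&\text{if }\alpha=\beta\end{cases}$$ is a cylinder box-counting measure.
   Context: Bara\'nski carpet: let $r,s\ge2$ be integers, and let $\{\Phi_{i,1}\}_{i=1}^r$, $\{\Phi_{j,2}\}_{j=1}^s$ be two families of contracting affine maps of $[0,1]$ into itself with positive derivatives $a_i=\Phi_{i,1}'$, $b_j=\Phi_{j,2}'$, such that the sets $\Phi_{i,1}([0,1))$, $1\le i\le r$, are pairwise disjoint and the sets $\Phi_{j,2}([0,1))$, $1\le j\le s$, are pairwise disjoint. Let $\mathcal D\subset\{1,\dots,r\}\times\{1,\dots,s\}$ be nonempty, and for $\mathbf d=(i,j)\in\mathcal D$ put $\Phi_{\mathbf d}(x,y)=(\Phi_{i,1}(x),\Phi_{j,2}(y))$, $a_{\mathbf d}=a_i$, $b_{\mathbf d}=b_j$. The attractor $\Lambda$ of the IFS $\{\Phi_{\mathbf d}\}_{\mathbf d\in\mathcal D}$ (the unique nonempty compact set with $\Lambda=\bigcup_{\mathbf d}\Phi_{\mathbf d}(\Lambda)$) is called a Bara\'nski carpet. Let $\pi_1(\mathcal D)$, $\pi_2(\mathcal D)$ be the projections of $\mathcal D$ to the first and second coordinates. Let $\alpha_1,\alpha_2,\beta_1,\beta_2$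 be the unique real numbers such that $$\sum_{i\in\pi_1(\mathcal D)}a_i^{\alpha_1}=1,\quad \sum_{\mathbf d\in\mathcal D}a_{\mathbf d}^{\alpha_1}b_{\mathbf d}^{\alpha_2}=1,\quad \sum_{j\in\pi_2(\mathcal D)}b_j^{\beta_1}=1,\quad \sum_{\mathbf d\in\mathcal D}b_{\mathbf d}^{\beta_1}a_{\mathbf d}^{\beta_2}=1 .$$ $\mu_A$ and $\mu_B$ are the Bernoulli measures on $\Lambda$ with probability weights $(a_{\mathbf d}^{\alpha_1}b_{\mathbf d}^{\alpha_2})_{\mathbf d\in\mathcal D}$ and $(b_{\mathbf d}^{\beta_1}a_{\mathbf d}^{\beta_2})_{\mathbf d\in\mathcal D}$, respectively; the Bernoulli measure with weight $(p_{\mathbf d})$ is the push-forward of the product measure on $\mathcal D^\infty$ under the coding map, i.e. the unique Borel probability measure with $\mu=\sum_{\mathbf d}p_{\mathbf d}\,\mu\circ\Phi_{\mathbf d}^{-1}$. For a compact metric space $X$, $A\subset X$ and $\delta>0$, $\mathcal N_\delta(A)$ is the maximal number of pairwise disjoint (open) balls of $X$ of radius $\delta$ with centers in $A$; $\dim_BX=\lim_{\delta\to0}\frac{\log\mathcal N_\delta(X)}{-\log\delta}$ when the limit exists. A compact Vitalli-type covering of $X$ is a sequence $\mathcal F=\{\mathcal F_k\}_{k\ge1}$ of coverings of $X$ such that (i) every element of $\mathcal F_k$ is compact; (ii) there is an integer $\lambda$ such that for all $k$ each point of $X$ lies in at most $\lambda$ elements of $\mathcal F_k$; (iii) $\max\{\operatorname{diam}A:A\in\mathcal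 F_k\}\to0$. A finite Borel measure $\mu$ on $X$ (with $\gamma=\dim_BX$ existing) is an $\mathcal F$-box-counting measure if there is $M>0$ such that for every $R\in\bigcup_k\mathcal F_k$ there is $\delta_0(R)>0$ with $M^{-1}\mu(R)\le\mathcal N_\delta(R)\delta^{\gamma}\le M\mu(R)$ for all $0<\delta\le\delta_0(R)$. Cylinder box-counting measure: a $k$-th cylinder of $\Lambda$ is a set $\Phi_{i_1}\circ\dots\circ\Phi_{i_k}(\Lambda)$ with $i_1\dots i_k\in\mathcal D^k$; let $\mathcal F_k$ be the collection of $k$-th cylinders. A finite Borel measure $\mu$ on $\Lambda$ is a cylinder box-counting measure if $\mathcal F=\{\mathcal F_k\}_{k\ge1}$ is a compact Vitalli-type covering of $\Lambda$ and $\mu$ is an $\mathcal F$-box-counting measure. *)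

(* Defs.v *)
From HB Require Import structures.
From mathcomp Require Import all_boot all_order all_algebra.
From mathcomp Require Import ring lra.
From mathcomp Require Import all_classical all_reals all_analysis.

Set Implicit Arguments.
Unset Strict Implicit.
Unset Printing Implicit Defensive.

Import Order.TTheory GRing.Theory Num.Theory.
Import numFieldNormedType.Exports.

Local Open Scope classical_set_scope.
Local Open Scope ring_scope.

#[short(type="pmetricType")]
HB.structure Definition PointedMetric (K : numDomainType) :=
  {T of Metric K T & isPointed T}.

(** The library's product [R * R] carries the sup distance; [plane R] is a
    separate alias carrying the Euclidean distance, hence its own (Euclidean)
    balls, topology and compact sets. *)
Definition plane (R : realType) : Type := (R * R)%type.

Section plane_metric.
Context {R : realType}.
Implicit Types x y z : plane R.

HB.instance Definition _ := Choice.copy (plane R) (R * R)%type.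
HB.instance Definition _ := isPointed.Build (plane R) (0, 0).

Definition euclid_dist x y : R :=
  Num.sqrt ((x.1 - y.1) ^+ 2 + (x.2 - y.2) ^+ 2).

Lemma euclid_dist_xx x : euclid_dist x x = 0.
Proof. by rewrite /euclid_dist !subrr expr0n /= addr0 sqrtr0. Qed.

Lemma euclid_dist_positivity x y : euclid_dist x y = 0 -> x = y.
Proof.
case: x y => [x1 x2] [y1 y2] /eqP; rewrite sqrtr_eq0 /= => h.
have h1 := sqr_ge0 (x1 - y1); have h2 := sqr_ge0 (x2 - y2).
have /eqP : (x1 - y1) ^+ 2 = 0 by lra.
have /eqP : (x2 - y2) ^+ 2 = 0 by lra.
by rewrite !sqrf_eq0 !subr_eq0 => /eqP -> /eqP ->.
Qed.

Lemma euclid_dist_sym x y : euclid_dist x y = euclid_dist y x.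
Proof. by rewrite /euclid_dist; congr Num.sqrt; ring. Qed.

Lemma euclid_dist_triangle y x z :
  euclid_dist x z <= euclid_dist x y + euclid_dist y z.
Proof.
case: x y z => [x1 x2] [y1 y2] [z1 z2]; rewrite /euclid_dist /=.
set a := x1 - y1; set b := x2 - y2; set c := y1 - z1; set d := y2 - z2.
have -> : x1 - z1 = a + c by rewrite /a /c; ring.
have -> : x2 - z2 = b + d by rewrite /b /d; ring.
have P (u v : R) : 0 <= u ^+ 2 + v ^+ 2 by rewrite addr_ge0 ?sqr_ge0.
rewrite -[leRHS]ger0_norm ?addr_ge0 ?sqrtr_ge0 // -sqrtr_sqr.
apply: ler_wsqrtr.
rewrite [leRHS]sqrrD (sqr_sqrtr (P a b)) (sqr_sqrtr (P c d)) -(sqrtrM _ (P a b)).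
suff : a * c + b * d <= Num.sqrt ((a ^+ 2 + b ^+ 2) * (c ^+ 2 + d ^+ 2)).
  by move=> ?; rewrite mulr2n; lra.
apply: (le_trans (ler_norm _)); rewrite -sqrtr_sqr; apply: ler_wsqrtr.
by rewrite -subr_ge0 (_ : _ - _ = (a * d - b * c) ^+ 2) ?sqr_ge0 //; ring.
Qed.

HB.instance Definition _ := @isMetric.Build R (plane R) euclid_dist
  euclid_dist_xx euclid_dist_positivity euclid_dist_sym euclid_dist_triangle.

End plane_metric.

Notation borel T := (g_sigma_algebraType (@open T)).

(** A compact metric space [X] is a compact subset of an ambient metric space
    [T]; balls, coverings and measures are those of the subspace [X]. *)
Section box_counting.
Context {R : realType} {T : pmetricType R}.
Implicit Types (X A : set T) (F : nat -> set (set T)).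

Definition rel_ball X (x : T) (delta : R) : set T := ball x delta `&` X.

(** Sets of centres are duplicate-free lists; disjoint balls being nonempty,
    distinct balls amount to distinct centres. *)
Definition packing X (delta : R) A : set (seq T) :=
  [set c | [/\ uniq c, forall x, x \in c -> A x &
    forall x y, x \in c -> y \in c -> x != y ->
      rel_ball X x delta `&` rel_ball X y delta = set0]].

(** For compact [X] and [0 < delta], sizes of packings are bounded, so this
    [sup] is a maximum. *)
Definition packing_number X (delta : R) A : R :=
  sup [set (size c)%:R | c in packing X delta A].

Definition has_box_dim X (gamma : R) : Prop :=
  (fun delta : R => ln (packing_number X delta X) / - ln delta) @ 0^'+
    --> gamma.

Definition diam A : R := sup [set mdist p.1 p.2 | p in A `*` A].

(** [F 0] is ignored: coverings are indexed by [k >= 1]. *)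
Definition vitali_covering X F : Prop :=
  [/\ forall k, (0 < k)%N -> \bigcup_(A in F k) A = X,
      forall k A, (0 < k)%N -> F k A -> compact A,
      exists lambda : nat, forall k x, (0 < k)%N -> X x ->
        ([set A | F k A /\ A x] #<= `I_lambda)%card &
      (fun k => sup [set diam A | A in F k]) @ \oo --> (0 : R)].

Definition finite_borel_measure_on X (mu : {measure set (borel T) -> \bar R})
    : Prop :=
  fin_num_fun mu /\ mu (~` X) = 0%E.

Definition box_counting_measure X F
    (mu : {measure set (borel T) -> \bar R}) : Prop :=
  finite_borel_measure_on X mu /\
  exists gamma : R, has_box_dim X gamma /\
  exists M : R, 0 < M /\
    forall k A, (0 < k)%N -> F k A ->
    exists delta0 : R, 0 < delta0 /\
      forall delta : R, 0 < delta <= delta0 ->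
        ((M^-1)%:E * mu A <= (packing_number X delta A * delta `^ gamma)%:E
         <= M%:E * mu A)%E.

End box_counting.

Section ifs.
Context {R : realType} {T : pmetricType R} {I : finType}.
Variables (f : I -> T -> T) (D : {set I}).

Definition attractor (L : set T) : Prop :=
  [/\ L !=set0, compact L & L = \bigcup_(d in [set` D]) (f d @` L)].

Definition word_map (w : seq I) : T -> T := foldr (fun d g => f d \o g) id w.

Definition cylinders (L : set T) (k : nat) : set (set T) :=
  [set word_map w @` L |
     w in [set w : seq I | size w = k /\ {subset w <= D}]].

Definition cylinder_box_counting_measure (L : set T)
    (mu : {measure set (borel T) -> \bar R}) : Prop :=
  vitali_covering L (cylinders L) /\ box_counting_measure L (cylinders L) mu.

Definition bernoulli_measure (L : set T) (p : I -> R)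
    (mu : probability (borel T) R) : Prop :=
  mu L = 1%E /\
  forall B : set (borel T), measurable B ->
    mu B = (\sum_(d in D) (p d)%:E * mu (f d @^-1` B))%E.

End ifs.

Section baranski.
Context {R : realType}.

Definition affine (a t x : R) : R := a * x + t.

Definition interval_contractions (n : nat) (a t : 'I_n -> R) : Prop :=
  [/\ forall i, 0 < a i < 1,
      forall i, affine (a i) (t i) @` `[0, 1] `<=` `[0, 1] &
      trivIset setT (fun i => affine (a i) (t i) @` `[0, 1[)].

Definition baranski_map (r s : nat) (a t : 'I_r -> R) (b u : 'I_s -> R)
    (d : 'I_r * 'I_s) (z : plane R) : plane R :=
  (affine (a d.1) (t d.1) z.1, affine (b d.2) (u d.2) z.2).

Definition carpet_measure (alpha beta : R)
    (muA muB : {measure set (borel (plane R)) -> \bar R})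
    : {measure set (borel (plane R)) -> \bar R} :=
  if beta < alpha then muA
  else if alpha < beta then muB
  else measure_add muA muB.

End baranski.

(* Main.v *)
Require Import Defs.
From mathcomp Require Import all_boot all_order all_algebra.
From mathcomp Require Import ring lra zify.
From mathcomp Require Import all_classical all_reals all_analysis.

(** Idea. Rescaling by a cylinder of width [A] and height [B] turns balls of
    radius [delta] into rectangles with sides [s = delta / A], [t = delta / B].
    The number of such rectangles needed to cover the carpet is, up to constants,
    additive along the subdivision [(s, t) -> (s / a_d, t / b_d)] until one side
    exceeds 1; then a one-dimensional projection remains, with count of order
    [t^-beta1] or [s^-alpha1]. The functions [hA = s^-alpha1 t^-alpha2] and
    [hB = s^-beta2 t^-beta1] are harmonic for the subdivision and have these
    orders at the two exits, so the count is at most [C (hA + hB)], and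
    [hA], [hB] at a cylinder are [delta^-alpha] and [delta^-beta] times its
    Bernoulli weights.

    For the lower bound by [hA] when [alpha >= beta], either both weights agree
    and [alpha = beta], so that [hA = hB] at all times, or Gibbs' inequality for the
    two weights shows that [ln (b / a)] has negative mean under the first one.
    In the latter case [(s / t)^eta hA] is multiplied by [theta < 1] at each
    subdivision step for small [eta > 0], so that [hA - (s / t)^eta hA] is subharmonic
    and nonpositive at the wrong exit, while its second term is negligible
    when [delta] is small compared with the cylinder. *)

Set Implicit Arguments.
Unset Strict Implicit.
Unset Printing Implicit Defensive.

Import Order.TTheory GRing.Theory Num.Theory.
Import numFieldNormedType.Exports.

Local Open Scope classical_set_scope.
Local Open Scope ring_scope.

(** * Power weights *)

Section weights.
Context {R : realType}.
Implicit Types (x y s t m e : R).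

Lemma powRDr x e e' : 0 < x -> x `^ (e + e') = x `^ e * x `^ e'.
Proof. by move=> x0; rewrite powRD // (gt_eqF x0) implybT. Qed.

Lemma powR_div x y e : 0 < x -> 0 < y -> (x / y) `^ (- e) = x `^ (- e) * y `^ e.
Proof.
move=> x0 y0; rewrite powRM ?invr_ge0 ?ltW // -[y^-1]powR_inv1 ?ltW //.
by rewrite -powRrM mulrNN mul1r.
Qed.

(** When a side first passes 1 it is at most [m^-1], so any power of it is bounded on both sides.
    The constants of the counts come from here. *)
Lemma powR_between m x e : 0 < m -> 1 <= x <= m^-1 ->
  (m `^ (- `|e|))^-1 <= x `^ e <= m `^ (- `|e|).
Proof.
move=> m0 /andP[x1 xm].
have x0 : 0 < x by apply: lt_le_trans x1.
have m1 : m <= 1 by rewrite -invf_ge1 // (le_trans x1).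
rewrite -powRN opprK /powR !gt_eqF // !ler_expR.
have l0 : 0 <= ln x by rewrite ln_ge0.
have l1 : ln x <= - ln m by rewrite -lnV ?posrE // ler_ln ?posrE // invr_gt0.
have := ler_norm e; have := ler_norm (- e); rewrite normrN => h1 h2.
apply/andP; split; have := normr_ge0 e; nra.
Qed.

Definition hfun e e' s t : R := s `^ (- e) * t `^ (- e').

Lemma hfun_gt0 e e' s t : 0 < s -> 0 < t -> 0 < hfun e e' s t.
Proof. by move=> s0 t0; rewrite mulr_gt0 // powR_gt0. Qed.

Lemma hfun_div e e' s t x y : 0 < s -> 0 < t -> 0 < x -> 0 < y ->
  hfun e e' (s / x) (t / y) = hfun e e' s t * (x `^ e * y `^ e').
Proof. by move=> s0 t0 x0 y0; rewrite /hfun !powR_div //; ring. Qed.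

(** So [hfun e e'] is harmonic for the subdivision as soon as the weights [A^e B^e'] sum to 1. *)
Lemma hfun_sum (I : finType) (D : {set I}) (A B : I -> R) e e' s t :
  0 < s -> 0 < t -> (forall i, 0 < A i) -> (forall i, 0 < B i) ->
  \sum_(i in D) hfun e e' (s / A i) (t / B i) =
  hfun e e' s t * \sum_(i in D) A i `^ e * B i `^ e'.
Proof.
by move=> s0 t0 A0 B0; rewrite mulr_sumr; apply: eq_bigr => i _; rewrite hfun_div.
Qed.

Lemma hfun_swap e e' s t : hfun e e' s t = hfun e' e t s.
Proof. by rewrite /hfun mulrC. Qed.

(** Tilting the exponents by [eta] inserts the factor [(s / t)^eta]; this gives the correction term
    of the drift argument. *)
Lemma hfun_shift e e' eta s t : 0 < s -> 0 < t ->
  hfun (e - eta) (e' + eta) s t = hfun e e' s t * (s / t) `^ eta.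
Proof.
move=> s0 t0; have := powR_div (- eta) s0 t0; rewrite opprK /hfun => ->.
by rewrite !opprD opprK !powRDr //; ring.
Qed.

End weights.

(** * Gibbs' inequality and exponential moments *)

Section gibbs.
Context {R : realType} {I : finType}.
Variables (D : {set I}).

Lemma ln_lt_sub1 (x : R) : 0 < x -> x != 1 -> ln x < x - 1.
Proof.
move=> x0 x1; have := @expR_gt1Dx R (ln x); rewrite lnK ?posrE // => h.
have : ln x != 0 by rewrite ln_eq0.
by move=> /h; lra.
Qed.

(** Termwise this is [p i] times [ln x <= x - 1] at [x = q i / p i], and the differences [q i - p i]
    add up to 0. The equality case is kept because strictness is needed when the two exponent sums
    coincide. *)
Lemma gibbs (p q : I -> R) :
  (forall i, i \in D -> 0 < p i) -> (forall i, i \in D -> 0 < q i) ->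
  \sum_(i in D) p i = 1 -> \sum_(i in D) q i = 1 ->
  \sum_(i in D) p i * (ln (q i) - ln (p i)) <= 0 ?= iff
    [forall i in D, p i == q i].
Proof.
move=> p0 q0 p1 q1.
rewrite [X in _ <= X ?= iff _](_ : _ = \sum_(i in D) (q i - p i)); last first.
  by rewrite sumrB p1 q1 subrr.
apply: leif_sum => i iD; have pi := p0 i iD; have qi := q0 i iD.
have E : q i - p i = p i * (q i / p i - 1).
  by rewrite mulrBr mulr1 mulrC divfK // gt_eqF.
have qp : 0 < q i / p i by rewrite divr_gt0.
rewrite -(ln_div qi pi) E; apply/leifP; case: eqP => [->|/eqP ne].
  by rewrite (divff (lt0r_neq0 qi)) ln1 subrr.
rewrite ltr_pM2l // ln_lt_sub1 //; apply: contraNneq ne => h.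
by rewrite -[q i](divfK (lt0r_neq0 pi)) h mul1r.
Qed.

End gibbs.

Section drift.
Context {R : realType} {I : finType}.

(** The moment equals 1 at [eta = 0] and its derivative there is the negative mean, so it drops
    below 1 for small [eta]. A quadratic bound on [expR] makes this explicit. *)
Lemma exp_moment_lt1 (D : {set I}) (p x : I -> R) :
  (forall i, i \in D -> 0 < p i) -> \sum_(i in D) p i = 1 ->
  \sum_(i in D) p i * x i < 0 ->
  exists2 eta, 0 < eta & \sum_(i in D) p i * expR (eta * x i) < 1.
Proof.
move=> p0 p1 m0.
pose M := 1 + \sum_(i in D) `|x i|.
have S0 : 0 <= \sum_(i in D) `|x i| by apply: sumr_ge0.
have M1 : 1 <= M by rewrite /M; lra.
have xM i : i \in D -> `|x i| <= M.
  by move=> iD; rewrite /M (bigD1 i) //= ; have : 0 <= \sum_(j in D | j != i) `|x j|;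
    [exact: sumr_ge0 | lra].
set mu := \sum_(i in D) _ in m0.
(* From [expR (- y) >= 1 - y], since [(1 + y + 2 y^2)(1 - y) = 1 + y^2 (1 - 2 y) >= 1] for
   [y <= 1/2]. *)
have E (y : R) : `|y| <= 2^-1 -> expR y <= 1 + y + 2 * y ^+ 2.
  move=> hy; have y2 : y <= 2^-1 by apply: le_trans hy; exact: ler_norm.
  have y3 : - 2^-1 <= y by move: hy; rewrite ler_norml => /andP[].
  have h := @expR_ge1Dx R (- y); have e0 := expR_gt0 y.
  have : expR y * expR (- y) = 1 by rewrite -expRD subrr expR0.
  have : (1 + y + 2 * y ^+ 2) * (1 - y) >= 1 by nra.
  by nra.
(* The first bound gives [|eta * x i| <= 1/2]; the second keeps the quadratic error [2 eta^2 M^2] at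
   most half of the linear gain [- eta * mu]. *)
pose eta := Num.min (2 * M)^-1 (- mu / (4 * M ^+ 2)).
have M0 : 0 < M by lra.
have eta0 : 0 < eta.
  by rewrite lt_min invr_gt0 divr_gt0 ?mulr_gt0 ?exprn_gt0 // oppr_gt0.
exists eta => //.
have e1 : eta * (2 * M) <= 1.
  by rewrite -ler_pdivlMr ?mulr_gt0 // div1r ge_min lexx.
have e2 : eta * (4 * M ^+ 2) <= - mu.
  by rewrite -ler_pdivlMr ?mulr_gt0 ?exprn_gt0 // ge_min lexx orbT.
apply: (@le_lt_trans _ _ (\sum_(i in D) (p i + eta * (p i * x i) +
    2 * eta ^+ 2 * M ^+ 2 * p i))).
  apply: ler_sum => i iD; have pi := p0 i iD; have xi := xM i iD.
  have x2 : x i ^+ 2 <= M ^+ 2 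
    by rewrite -(real_normK (num_real (x i))) ler_sqr ?nnegrE // ltW.
  have := E (eta * x i); rewrite normrM (gtr0_norm eta0) => /(_ _) h.
  have {}h : expR (eta * x i) <= 1 + eta * x i + 2 * (eta * x i) ^+ 2.
    by apply: h; nra.
  have h3 : (eta * x i) ^+ 2 <= eta ^+ 2 * M ^+ 2.
    by rewrite exprMn ler_wpM2l // sqr_ge0.
  have : p i * expR (eta * x i) <= p i * (1 + eta * x i + 2 * (eta ^+ 2 * M ^+ 2)).
    by rewrite ler_pM2l //; lra.
  lra.
rewrite !big_split /= p1 -!mulr_sumr p1 -/mu.
by nra.
Qed.

End drift.

(** * Comparison of the exponents *)

Section exponents.
Context {R : realType} {I : finType}.
Variables (D : {set I}) (A B : I -> R) (a1 a2 b1 b2 : R).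
Hypotheses (A01 : forall i, 0 < A i < 1) (B01 : forall i, 0 < B i < 1).

Let A0 i : 0 < A i. Proof. by have /andP[] := A01 i. Qed.
Let B0 i : 0 < B i. Proof. by have /andP[] := B01 i. Qed.

(** Since [A i < 1], the sum strictly decreases as the exponent of [A] grows, so an order between
    sums gives the reverse order between exponents. *)
Lemma exponent_le e : D != finset.set0 ->
  \sum_(i in D) B i `^ b1 * A i `^ e <= \sum_(i in D) B i `^ b1 * A i `^ b2 ->
  b2 <= e.
Proof.
move=> D0; apply: contraTT; rewrite -!ltNge => eb.
have /finset.set0Pn[d dD] := D0.
apply: ltr_sum => [|i iD]; first by apply/hasP; exists d; rewrite ?mem_index_enum.
rewrite ltr_pM2l ?powR_gt0 //.
by rewrite /powR (gt_eqF (A0 i)) ltr_expR ltr_nM2r // ln_lt0.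
Qed.

(* With [u], [v] the means of [- ln A], [- ln B] under [p = A^a1 B^a2], Gibbs'
   inequality reads [(a1 - b2) u <= (b1 - a2) v]. *)
Lemma moment_lt1 :
  \sum_(i in D) A i `^ a1 * B i `^ a2 = 1 ->
  \sum_(i in D) B i `^ b1 * A i `^ b2 = 1 ->
  b2 <= a1 -> a2 <= b1 ->
  b1 + b2 < a1 + a2 \/ b1 + b2 = a1 + a2 /\
    (exists2 i, i \in D & A i `^ a1 * B i `^ a2 != B i `^ b1 * A i `^ b2) ->
  exists2 eta, 0 < eta &
    \sum_(i in D) A i `^ (a1 - eta) * B i `^ (a2 + eta) < 1.
Proof.
move=> p1 q1 k1 k2 hab.
pose p i := A i `^ a1 * B i `^ a2; pose q i := B i `^ b1 * A i `^ b2.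
have p0 i : i \in D -> 0 < p i by move=> _; rewrite mulr_gt0 ?powR_gt0.
have q0 i : i \in D -> 0 < q i by move=> _; rewrite mulr_gt0 ?powR_gt0.
have G := gibbs p0 q0 p1 q1.
pose u := \sum_(i in D) p i * ln (A i); pose v := \sum_(i in D) p i * ln (B i).
have E : \sum_(i in D) p i * (ln (q i) - ln (p i)) = (b1 - a2) * v - (a1 - b2) * u.
  rewrite /u /v !mulr_sumr -sumrB; apply: eq_bigr => i iD.
  by rewrite !lnM ?posrE ?powR_gt0 // !ln_powR; ring.
have v0 : v < 0.
  rewrite -oppr_gt0 -sumrN.
  have D0 : has (fun i => i \in D) (index_enum I).
    apply: contraPT p1 => /hasPn hD; rewrite big1 ?(eq_sym 0) //.
      by apply/eqP; rewrite eq_sym oner_neq0.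
    by move=> i iD; have := hD i (mem_index_enum i); rewrite iD.
  have := @ltr_sum R I (index_enum I) (mem D) (fun=> 0) (fun i => - (p i * ln (B i))) D0.
  rewrite big1 // => h; apply: h => i iD.
  by rewrite oppr_gt0 pmulr_rlt0 ?p0 // ln_lt0.
(* Here [u], [v] are the means of [ln A], [ln B] themselves. With [k1 = a1 - b2] and [k2 = b1 - a2],
   the Gibbs sum is [k1 (v - u) - (k1 - k2) v]. If [u <= v], it would be nonnegative, and positive
   when [k1 > k2]; when [k1 = k2], the equality case of Gibbs excludes the value 0. *)
have uv : v - u < 0.
  move: G; rewrite E => -[Gle Geq]; case: hab => [hab|[hab [i iD ne]]]; first by nra.
  have : (b1 - a2) * v - (a1 - b2) * u != 0.
    by rewrite Geq; apply/forallPn; exists i; rewrite iD.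
  move=> ne0; have : (b1 - a2) * v - (a1 - b2) * u < 0 by rewrite lt_neqAle ne0.
  nra.
have [eta eta0 he] := @exp_moment_lt1 R I D p (fun i => ln (B i) - ln (A i)) p0 p1 ltac:(
  under eq_bigr do rewrite mulrBr; by rewrite sumrB).
(* Tilting [p] by [expR (eta * (ln B - ln A))] shifts the exponents to [a1 - eta] and [a2 + eta]. *)
exists eta => //; apply: le_lt_trans he; apply: ler_sum => i iD.
rewrite /p /powR (gt_eqF (A0 i)) (gt_eqF (B0 i)) -!expRD ler_expR.
by rewrite le_eqVlt; apply/orP; left; apply/eqP; ring.
Qed.

End exponents.

(** * Induction on scales *)

Section scale_induction.
Context {R : realType} {I : finType}.
Variables (D : {set I}) (A B : I -> R) (m rho : R).
Hypotheses (m0 : 0 < m) (rho1 : rho < 1).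
Hypotheses (Am : forall i, m <= A i <= rho) (Bm : forall i, m <= B i <= rho).

Lemma exists_expr_lt (x e : R) : 0 <= x < 1 -> 0 < e -> exists k, x ^+ k < e.
Proof.
move=> /andP[x0 x1] e0.
have /cvgrPdist_lt /(_ e e0) [N _ hN] : (fun n => x ^+ n) @ \oo --> (0 : R).
  by apply: cvg_expr; rewrite ger0_norm.
exists N; have := hN N (leqnn N).
by rewrite /= sub0r normrN ger0_norm ?exprn_ge0.
Qed.

(** Each subdivision multiplies the sides by at least [rho^-1], so one of them reaches 1 after
    finitely many steps. A step starts with both sides below 1 and multiplies them by at most
    [m^-1], so no side ever exceeds [m^-1]. *)
Lemma scale_ind (P : R -> R -> Prop) :
  (forall s t, 0 < s <= m^-1 -> 0 < t <= m^-1 -> 1 <= s \/ 1 <= t -> P s t) ->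
  (forall s t, 0 < s < 1 -> 0 < t < 1 ->
    (forall i, i \in D -> P (s / A i) (t / B i)) -> P s t) ->
  forall s t, 0 < s <= m^-1 -> 0 < t <= m^-1 -> P s t.
Proof.
move=> Pexit Pstep.
have step (C : I -> R) s i : (forall i, m <= C i <= rho) -> 0 < s < 1 ->
    0 < s / C i <= m^-1 /\ s / rho <= s / C i.
  move=> Cm /andP[s0 s1]; have /andP[mC Cr] := Cm i.
  have C0 : 0 < C i by apply: lt_le_trans mC.
  have r0 : 0 < rho by apply: lt_le_trans Cr.
  rewrite divr_gt0 // ler_pM2l // lef_pV2 ?posrE // Cr; split=> //=.
  by rewrite ler_pdivrMr // mulrC ler_pdivlMr //; nra.
suff H k s t : 0 < s <= m^-1 -> 0 < t <= m^-1 -> rho ^+ k <= s -> P s t.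
  move=> s t hs ht; have /andP[s0 _] := hs.
  have [r0|r0] := leP 0 rho.
    have rho01 : 0 <= rho < 1 by rewrite r0.
    have [k hk] := exists_expr_lt rho01 s0.
    exact: (H k _ _ hs ht (ltW hk)).
  (* [rho < 0] is possible only for empty [I]; then [rho ^+ 1 <= s] holds trivially. *)
  by apply: (H 1%N) => //; rewrite expr1; lra.
elim: k s t => [|k IH] s t hs ht hk; first by apply: Pexit => //; left.
have [s1|s1] := leP 1 s; first by apply: Pexit => //; left.
have [t1|t1] := leP 1 t; first by apply: Pexit => //; right.
have /andP[s0 _] := hs; have /andP[t0 _] := ht.
apply: Pstep; rewrite ?s0 ?t0 // => i iD.
have [sA sr] := step A s i Am ltac:(by rewrite s0).
have [tB _] := step B t i Bm ltac:(by rewrite t0).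
apply: IH => //; apply: le_trans sr.
have r0 : 0 < rho.
  by have /andP[h1 h2] := Am i; apply: (lt_le_trans m0); apply: le_trans h2.
by rewrite ler_pdivlMr // mulrC -exprS.
Qed.

Lemma choose_sum_ge (P : I -> nat -> Prop) (f : I -> R) :
  (forall i, i \in D -> exists n, P i n /\ f i <= n%:R) ->
  exists n : I -> nat, (forall i, i \in D -> P i (n i)) /\
    \sum_(i in D) f i <= (\sum_(i in D) n i)%:R.
Proof.
move=> H; have /choice[n hn] : forall i, exists n, i \in D -> P i n /\ f i <= n%:R.
  by move=> i; have [/H[n hn]|_] := boolP (i \in D); [exists n | exists 0%N].
exists n; split=> [i /hn[]//|].
by rewrite natr_sum; apply: ler_sum => i /hn[].
Qed.

Lemma choose_sum_le (P : I -> nat -> Prop) (f : I -> R) :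
  (forall i, i \in D -> exists n, P i n /\ n%:R <= f i) ->
  exists n : I -> nat, (forall i, i \in D -> P i (n i)) /\
    (\sum_(i in D) n i)%:R <= \sum_(i in D) f i.
Proof.
move=> H; have /choice[n hn] : forall i, exists n, i \in D -> P i n /\ n%:R <= f i.
  by move=> i; have [/H[n hn]|_] := boolP (i \in D); [exists n | exists 0%N].
exists n; split=> [i /hn[]//|].
by rewrite natr_sum; apply: ler_sum => i /hn[].
Qed.

End scale_induction.

(** * Growth of additive families of counts *)

Section growth.
Context {R : realType} {I : finType}.
Variables (D : {set I}) (A B : I -> R) (m rho : R).
Hypotheses (m0 : 0 < m) (rho1 : rho < 1).
Hypotheses (Am : forall i, m <= A i <= rho) (Bm : forall i, m <= B i <= rho).
Variables (F : R -> R -> nat -> Prop).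
Hypothesis F_sum : forall s t (n : I -> nat), 0 < s -> 0 < t ->
  (forall i, i \in D -> F (s / A i) (t / B i) (n i)) ->
  F s t (\sum_(i in D) n i)%N.
Variables (a1 a2 b1 b2 : R).
Hypothesis p1 : \sum_(i in D) A i `^ a1 * B i `^ a2 = 1.
Hypothesis q1 : \sum_(i in D) A i `^ b2 * B i `^ b1 = 1.

Let A0 i : 0 < A i.
Proof. by have /andP[h _] := Am i; apply: lt_le_trans h. Qed.
Let B0 i : 0 < B i.
Proof. by have /andP[h _] := Bm i; apply: lt_le_trans h. Qed.

(** [F s t n] stands for a family of [n] rectangles with sides [s], [t], here a covering. The bound
    is harmonic and dominates the estimate at each exit, so it propagates inwards by [scale_ind]. *)
Lemma growth_le K : 0 <= K ->
  (forall s t, 0 < s <= m^-1 -> 0 < t <= m^-1 -> 1 <= t ->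
    exists n, F s t n /\ n%:R <= K * hfun a1 a2 s t) ->
  (forall s t, 0 < s <= m^-1 -> 0 < t <= m^-1 -> 1 <= s ->
    exists n, F s t n /\ n%:R <= K * hfun b2 b1 s t) ->
  forall s t, 0 < s <= m^-1 -> 0 < t <= m^-1 ->
    exists n, F s t n /\ n%:R <= K * (hfun a1 a2 s t + hfun b2 b1 s t).
Proof.
move=> K0 FA FB.
apply: (@scale_ind R I D A B m rho) => // [s t hs ht|s t hs ht IH].
  have /andP[s0 _] := hs; have /andP[t0 _] := ht.
  have hA := @hfun_gt0 R a1 a2 s t s0 t0; have hB := @hfun_gt0 R b2 b1 s t s0 t0.
  by case=> [/(FB _ _ hs ht)|/(FA _ _ hs ht)] [n [Fn hn]]; exists n; split=> //; nra.
have [n [Fn hn]] := choose_sum_le IH.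
have /andP[s0 _] := hs; have /andP[t0 _] := ht.
exists (\sum_(i in D) n i)%N; split; first exact: F_sum.
apply: (le_trans hn).
by rewrite -mulr_sumr big_split /= !hfun_sum // p1 q1 !mulr1.
Qed.

(** Equal weights preserve the equality of the two harmonic functions under subdivision, so at
    either exit the known bound is a bound in terms of [hfun a1 a2]. *)
Lemma growth_ge_balanced K : 
  (forall i, i \in D -> A i `^ a1 * B i `^ a2 = A i `^ b2 * B i `^ b1) ->
  (forall s t, 0 < s <= m^-1 -> 0 < t <= m^-1 -> 1 <= t ->
    exists n, F s t n /\ K * hfun a1 a2 s t <= n%:R) ->
  (forall s t, 0 < s <= m^-1 -> 0 < t <= m^-1 -> 1 <= s ->
    exists n, F s t n /\ K * hfun b2 b1 s t <= n%:R) ->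
  forall s t, 0 < s <= m^-1 -> 0 < t <= m^-1 ->
    hfun a1 a2 s t = hfun b2 b1 s t ->
    exists n, F s t n /\ K * hfun a1 a2 s t <= n%:R.
Proof.
move=> pq FA FB.
apply: (@scale_ind R I D A B m rho) => // [s t hs ht|s t hs ht IH] hAB.
  by case: hAB => [/(FB _ _ hs ht)|/(FA _ _ hs ht)] [n [Fn hn]] hAB;
    exists n; split=> //; rewrite ?hAB.
have /andP[s0 _] := hs; have /andP[t0 _] := ht.
have {}IH i : i \in D -> exists n, F (s / A i) (t / B i) n /\
    K * hfun a1 a2 (s / A i) (t / B i) <= n%:R.
  by move=> iD; apply: IH => //; rewrite !hfun_div // hAB pq.
have [n [Fn hn]] := choose_sum_ge IH.
exists (\sum_(i in D) n i)%N; split; first exact: F_sum.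
by apply: le_trans hn; rewrite -mulr_sumr !hfun_sum // p1 mulr1.
Qed.

Hypothesis F_nil : forall s t, F s t 0.

(* [h (1 - (s/t)^eta)] is subharmonic for the subdivision and nonpositive where
   the first coordinate is exhausted before the second. *)
Lemma growth_ge_drift K eta : 0 <= K -> 0 < eta ->
  (forall s t, 0 < s <= m^-1 -> 0 < t <= m^-1 -> 1 <= t ->
    exists n, F s t n /\ K * hfun a1 a2 s t <= n%:R) ->
  let theta := \sum_(i in D) A i `^ (a1 - eta) * B i `^ (a2 + eta) in
  theta <= 1 ->
  forall k s t, 0 < s <= m ^+ k / m -> 0 < t <= m ^+ k / m ->
    exists n, F s t n /\
      K * (hfun a1 a2 s t * (1 - theta ^+ k * (s / t) `^ eta)) <= n%:R.
Proof.
move=> K0 eta0 FA theta th1.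
have th0 : 0 <= theta by apply: sumr_ge0 => i _; rewrite mulr_ge0 ?powR_ge0.
pose g := hfun (a1 - eta) (a2 + eta).
(* [hfun a1 a2] is harmonic, while the values of [g] at the children add up to [theta * g s t]: each
   subdivision brings a factor [theta] into the correction. *)
have hstep k s t : 0 < s -> 0 < t ->
    (forall i, i \in D -> exists n, F (s / A i) (t / B i) n /\
      K * (hfun a1 a2 (s / A i) (t / B i) - theta ^+ k * g (s / A i) (t / B i))
        <= n%:R) ->
    exists n : I -> nat, (forall i, i \in D -> F (s / A i) (t / B i) (n i)) /\
      K * (hfun a1 a2 s t - theta ^+ k.+1 * g s t) <= (\sum_(i in D) n i)%:R.
  move=> s0 t0 /choose_sum_ge[n [Fn hn]]; exists n; split=> //.
  apply: le_trans hn; rewrite -mulr_sumr sumrB -mulr_sumr /g !hfun_sum // p1 mulr1.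
  by rewrite -/theta exprSr -mulrA [theta * _]mulrC.
suff H k s t : 0 < s <= m ^+ k / m -> 0 < t <= m ^+ k / m ->
    exists n, F s t n /\ K * (hfun a1 a2 s t - theta ^+ k * g s t) <= n%:R.
  move=> k s t hs ht; have [n [Fn hn]] := H k s t hs ht; exists n; split=> //.
  have /andP[s0 _] := hs; have /andP[t0 _] := ht.
  apply: le_trans hn; rewrite /g hfun_shift // le_eqVlt; apply/orP; left.
  by apply/eqP; ring.
elim: k s t => [|k IH] s t.
  rewrite !expr0 !mul1r; move: s t.
  apply: (@scale_ind R I D A B m rho) => // [s t hs ht|s t hs ht IH].
    have /andP[s0 _] := hs; have /andP[t0 _] := ht.
    have hA := @hfun_gt0 R a1 a2 s t s0 t0.
    have g0 : 0 < g s t by apply: hfun_gt0.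
    have [t1 _|t1] := leP 1 t.
      by have [n [Fn hn]] := FA _ _ hs ht t1; exists n; split=> //; nra.
    (* Wrong exit: [t < 1 <= s], so [(s / t)^eta >= 1], the bound is nonpositive and the empty
       family will do. *)
    case=> [s1|]; last lra.
    exists 0%N; split; first exact: F_nil.
    rewrite /g hfun_shift //.
    have : 1 <= (s / t) `^ eta.
      rewrite -[leLHS](powRr0 (s / t)); apply: ler_powR; last exact: ltW.
      by rewrite ler_pdivlMr // mul1r; lra.
    by move=> h1; rewrite mulr_ge0_le0 //; nra.
  have /andP[s0 _] := hs; have /andP[t0 _] := ht.
  have [|n [Fn hn]] := hstep 0%N s t s0 t0.
    by under eq_forall do rewrite expr0 mul1r.
  exists (\sum_(i in D) n i)%N; split; first exact: F_sum.
  apply: le_trans hn; rewrite expr1; have g0 : 0 < g s t by apply: hfun_gt0.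
  by rewrite ler_wpM2l //; nra.
(* Dividing by slopes at least [m] costs one power of [m]; the initial bound [m ^+ k / m] thus
   allows [k] full subdivisions, each contributing a factor [theta]. *)
rewrite exprSr mulfK ?(gt_eqF m0) // => /andP[s0 sm] /andP[t0 tm].
have div_le (C : I -> R) x i : (forall i, m <= C i <= rho) -> 0 < x <= m ^+ k ->
    0 < x / C i <= m ^+ k / m.
  move=> Cm /andP[x0 xm]; have /andP[mC _] := Cm i.
  have C0 : 0 < C i by apply: lt_le_trans mC.
  rewrite divr_gt0 //=; apply: ler_pM => //; rewrite ?invr_ge0 ?(ltW x0) ?(ltW C0) //.
  by rewrite lef_pV2.
have [i _|n [Fn hn]] := hstep k s t s0 t0.
  by apply: IH; apply: div_le; rewrite ?s0 ?t0.
by exists (\sum_(i in D) n i)%N; split => //; apply: F_sum.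
Qed.

End growth.

(** * Coverings and spread families of rectangles *)

Section families.
Context {R : realType}.
Implicit Types (S : set (R * R)) (s t m : R) (p z : R * R).

Definition near_corner s t z p : bool := (`|z.1 - p.1| <= s) && (`|z.2 - p.2| <= t).

Definition unit_square : set (R * R) := [set z | 0 <= z.1 <= 1 /\ 0 <= z.2 <= 1].

(** The listed points need not lie in [S]; in the row argument they are placed on the line of
    abscissa 0. *)
Definition covered S s t (n : nat) : Prop := exists2 l : seq (R * R),
  size l = n & forall z, S z -> exists2 p, p \in l & near_corner s t z p.

(* [p] is the lower left corner of a rectangle of the unit square with sides
   [s], [t]. *)
Definition corner s t p : bool := (0 <= p.1 <= 1 - s) && (0 <= p.2 <= 1 - t).

Definition apart s t p p' : bool := (s <= `|p.1 - p'.1|) || (t <= `|p.2 - p'.2|).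

(* Disjoint rectangles, unlike separated points, remain disjoint when the families
   of several cylinders are put together, so these counts add up without loss. *)
Definition spread m S s t (n : nat) : Prop := exists l : seq ((R * R) * (R * R)),
  [/\ size l = n,
      forall e, e \in l -> [/\ S e.1, near_corner s t e.1 e.2 & corner (m * s) (m * t) e.2] &
      pairwise (fun e e' => apart (m * s) (m * t) e.2 e'.2) l].

Lemma spread0 m S s t : spread m S s t 0.
Proof. by exists [::]; split. Qed.

Lemma pairwise_flatten (T : Type) (r : rel T) (ss : seq (seq T)) :
  pairwise r (flatten ss) = all (pairwise r) ss && pairwise (allrel r) ss.
Proof.
elim: ss => //= l ss IH; rewrite pairwise_cat IH; case: (pairwise r l) => /=;
  rewrite ?andbF // andbCA; congr (_ && (_ && _)).
elim: ss {IH} => [|l' ss IH] /=; first by rewrite allrel0r.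
by rewrite allrel_catr IH.
Qed.

(** [f] moves the points of [S] and [g] the corners. The maps are separate because in a row the lift
    of a point may change its first coordinate arbitrarily, while corners are moved affinely. *)
Lemma spread_sum m S s t (I : finType) (D : {set I}) (s' t' : I -> R)
    (n : I -> nat) (f g : I -> R * R -> R * R) :
  (forall i, i \in D -> spread m S (s' i) (t' i) (n i)) ->
  (forall i z p, i \in D -> S z -> near_corner (s' i) (t' i) z p ->
    corner (m * s' i) (m * t' i) p ->
    [/\ S (f i z), near_corner s t (f i z) (g i p) & corner (m * s) (m * t) (g i p)]) ->
  (forall i p p', i \in D -> apart (m * s' i) (m * t' i) p p' ->
    apart (m * s) (m * t) (g i p) (g i p')) ->
  (forall i j p q, i \in D -> j \in D -> i != j ->
    corner (m * s' i) (m * t' i) p -> corner (m * s' j) (m * t' j) q ->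
    apart (m * s) (m * t) (g i p) (g j q)) ->
  spread m S s t (\sum_(i in D) n i).
Proof.
move=> H hf hg hgg.
have /choice[l hl] : forall i, exists l : seq ((R * R) * (R * R)), i \in D ->
  [/\ size l = n i,
    forall e, e \in l -> [/\ S e.1, near_corner (s' i) (t' i) e.1 e.2 &
      corner (m * s' i) (m * t' i) e.2] &
    pairwise (fun e e' => apart (m * s' i) (m * t' i) e.2 e'.2) l].
  by move=> i; have [/H[l hl]|_] := boolP (i \in D); [exists l | exists [::]].
pose fg i (e : (R * R) * (R * R)) := (f i e.1, g i e.2).
exists (flatten [seq map (fg i) (l i) | i <- enum D]); split.
- rewrite size_flatten /shape -map_comp sumnE big_map big_enum /=.
  by apply: eq_bigr => i /hl[<- _ _]; rewrite size_map.
- move=> e /flatten_mapP[i]; rewrite mem_enum => iD /mapP[e' e'l ->] /=.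
  by have [_ /(_ _ e'l)[? ? ?] _] := hl i iD; apply: hf.
rewrite pairwise_flatten; apply/andP; split.
  apply/allP => k /mapP[i]; rewrite mem_enum => iD -> {k}; rewrite pairwise_map.
  have [_ _] := hl i iD; apply: sub_pairwise => e e' /=; exact: hg.
rewrite pairwise_map; have : {in enum D &, forall i j, i != j ->
    allrel (fun e e' => apart (m * s) (m * t) e.2 e'.2)
      (map (fg i) (l i)) (map (fg j) (l j))}.
  move=> i j; rewrite !mem_enum => iD jD ij; apply/allrelP.
  move=> _ _ /mapP[e el ->] /mapP[e' el' ->] /=.
  have [_ /(_ _ el)[_ _ ce] _] := hl i iD; have [_ /(_ _ el')[_ _ ce'] _] := hl j jD.
  exact: hgg.
have : pairwise (fun i j => i != j) (enum D) by rewrite -uniq_pairwise enum_uniq.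
elim: (enum D) => //= i e IH /andP[ie pe] h; rewrite IH ?andbT //; last first.
  by move=> j k je ke; apply: h; rewrite inE ?je ?ke orbT.
apply/allP => j je; apply: h; rewrite ?inE ?eqxx ?je ?orbT //.
by have /allP := ie; apply.
Qed.

Lemma covered_sum S s t (I : finType) (D : {set I}) (s' t' : I -> R)
    (n : I -> nat) (g : I -> R * R -> R * R) :
  (forall i, i \in D -> covered S (s' i) (t' i) (n i)) ->
  (forall z, S z -> exists i z', [/\ i \in D, S z' &
    forall p, near_corner (s' i) (t' i) z' p -> near_corner s t z (g i p)]) ->
  covered S s t (\sum_(i in D) n i).
Proof.
move=> H hg.
have /choice[l hl] : forall i, exists l : seq (R * R), i \in D ->
  size l = n i /\ forall z, S z -> exists2 p, p \in l & near_corner (s' i) (t' i) z p.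
  by move=> i; have [/H[l hl]|_] := boolP (i \in D); [exists l | exists [::]].
exists (flatten [seq map (g i) (l i) | i <- enum D]).
  rewrite size_flatten /shape -map_comp sumnE big_map big_enum /=.
  by apply: eq_bigr => i /hl[<- _]; rewrite size_map.
move=> z /hg[i [z' [iD Sz' hz]]]; have [_ /(_ z' Sz')[p pl hp]] := hl i iD.
exists (g i p); last exact: hz.
by apply/flatten_mapP; exists i; rewrite ?mem_enum //; apply: map_f.
Qed.

(** Exchanging the coordinates derives the statements on columns from those on rows. *)
Definition swap z : R * R := (z.2, z.1).

Lemma near_corner_swap s t z p : near_corner s t (swap z) (swap p) = near_corner t s z p.
Proof. by rewrite /near_corner andbC. Qed.

Lemma corner_swap s t p : corner s t (swap p) = corner t s p.
Proof. by rewrite /corner andbC. Qed.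

Lemma apart_swap s t p q : apart s t (swap p) (swap q) = apart t s p q.
Proof. by rewrite /apart orbC. Qed.

Lemma swapK : involutive swap. Proof. by case. Qed.

Lemma spread_swap m S s t n : spread m (swap @` S) t s n -> spread m S s t n.
Proof.
move=> [l [ln hl pl]]; exists [seq (swap e.1, swap e.2) | e <- l]; split.
- by rewrite size_map.
- move=> _ /mapP[e /hl[[z Sz <-] w c] ->] /=.
  by rewrite swapK corner_swap -near_corner_swap swapK.
rewrite pairwise_map; apply: sub_pairwise pl => e e' /=.
by rewrite apart_swap.
Qed.

Lemma covered_swap S s t n : covered (swap @` S) t s n -> covered S s t n.
Proof.
move=> [l ln hl]; exists (map swap l); first by rewrite size_map.
move=> z Sz; have [|p pl wp] := hl (swap z); first by exists z.
by exists (swap p); [apply: map_f | rewrite -[z]swapK near_corner_swap].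
Qed.

End families.

(** * One-dimensional counts when the first side is exhausted *)

Section row_growth.
Context {R : realType} {I : finType}.
Variables (S : set (R * R)) (J : {set I}) (b u : I -> R) (m rho beta : R).
Hypotheses (m0 : 0 < m) (rho1 : rho < 1) (bm : forall i, m <= b i <= rho).
Hypotheses (u_ge0 : forall i, 0 <= u i) (bu_le1 : forall i, b i + u i <= 1).
Hypothesis b_sep : forall i j, i != j -> b i + u i <= u j \/ b j + u j <= u i.
Hypothesis S_sub : S `<=` unit_square.
Hypothesis S_neq0 : S !=set0.
Hypothesis S_lift : forall i z, i \in J -> S z ->
  exists2 z', S z' & z'.2 = b i * z.2 + u i.
Hypothesis S_split : forall z, S z ->
  exists i z', [/\ i \in J, S z' & z.2 = b i * z'.2 + u i].
Hypothesis b_beta : \sum_(i in J) b i `^ beta = 1.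

Let b0 i : 0 < b i.
Proof. by have /andP[h _] := bm i; apply: lt_le_trans h. Qed.

Let sum_div t : 0 < t -> \sum_(i in J) (t / b i) `^ (- beta) = t `^ (- beta).
Proof.
move=> t0; rewrite -[RHS]mulr1 -b_beta mulr_sumr.
by apply: eq_bigr => i _; rewrite powR_div.
Qed.

Let K := m `^ (- `|beta|).

Let K_between t : 1 <= t <= m^-1 -> K^-1 <= t `^ (- beta) <= K.
Proof. by move=> ht; have := powR_between (- beta) m0 ht; rewrite normrN. Qed.

(** For [s >= 1] only second coordinates count. Their projection is self-similar with ratios [b i],
    and [t^-beta] is harmonic for [t -> t / b i] and of order 1 once [t >= 1]. *)
Lemma row_spread s t : 1 <= s <= m^-1 -> 0 < t <= m^-1 ->
  exists n, spread m S s t n /\ K^-1 * t `^ (- beta) <= n%:R.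
Proof.
move=> /andP[s1 sm] ht.
(* The factor [m] in [spread] makes a rectangle with sides [m s], [m t] fit into the unit square
   even at an exit. *)
have ms1 x : 0 < x <= m^-1 -> m * x <= 1.
  by move=> /andP[x0 xm]; rewrite mulrC -ler_pdivlMr // div1r.
have s0 : 0 < s by lra.
have hs : 0 < s <= m^-1 by rewrite s0.
(* [scale_ind] handles two scales; here both are taken equal to [t]. *)
suff H t1 t2 : 0 < t1 <= m^-1 -> 0 < t2 <= m^-1 -> t1 = t2 ->
    exists n, spread m S s t1 n /\ K^-1 * t1 `^ (- beta) <= n%:R by exact: (H t t).
move: t1 t2; apply: (scale_ind m0 rho1 bm bm) => [t1 t2 h1 _ h12 e|t1 t2 h1 _ IH e].
  have t11 : 1 <= t1 by case: h12; rewrite -?e.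
  exists 1%N; split; last first.
    have /andP[_ tm] := h1; have t1m : 1 <= t1 <= m^-1 by rewrite t11.
    have /andP[_ hK] := K_between t1m.
    by rewrite mulrC ler_pdivrMr ?mul1r // powR_gt0.
  have [z Sz] := S_neq0; exists [:: (z, (0, 0))]; split => // e'.
  rewrite inE => /eqP -> /=; split=> //.
    have [/andP[? ?] /andP[? ?]] := S_sub Sz.
    by rewrite /near_corner /= !subr0 !ger0_norm //; apply/andP; split; lra.
  by rewrite /corner /= lexx /= !subr_ge0 !ms1.
have /andP[t0 _] := h1.
have {}IH i : i \in J -> exists n, spread m S s (t1 / b i) n /\
   K^-1 * (t1 / b i) `^ (- beta) <= n%:R by move=> iJ; apply: IH => //; rewrite e.
have [n [Fn hn]] := choose_sum_ge IH.
exists (\sum_(i in J) n i)%N; split; last first.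
  by move: hn; rewrite -mulr_sumr sum_div.
have /choice[f hf] : forall iz : I * (R * R), exists z', iz.1 \in J -> S iz.2 ->
    S z' /\ z'.2 = b iz.1 * iz.2.2 + u iz.1.
  move=> [i z] /=; have [iJ|_] := boolP (i \in J); last by exists z.
  by have [/(S_lift iJ)[z']|nS] := pselect (S z); [exists z'|exists z].
have mt i : b i * (m * (t1 / b i)) = m * t1.
  by rewrite mulrCA [b i * _]mulrC divfK ?(gt_eqF (b0 i)).
apply: (@spread_sum R m S s t1 I J (fun=> s) (fun i => t1 / b i) n
  (fun i z => f (i, z)) (fun i p => (p.1, b i * p.2 + u i))) => //.
- move=> i z p iJ Sz /andP[_ w2] /andP[/= /andP[p10 p11] /andP[p20 p21]].
  have [Sf f2] := hf (i, z) iJ Sz; rewrite /= in f2; split=> //.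
    (* The first coordinate of the lift is not controlled, but both abscissae lie in the unit
       interval and [s >= 1]. *)
    apply/andP; split=> /=.
      have [/andP[? ?] _] := S_sub Sf.
      have ms0 : 0 < m * s by rewrite mulr_gt0.
      by rewrite ler_norml; apply/andP; split; lra.
    rewrite f2 (_ : _ - _ = b i * (z.2 - p.2)); last ring.
    by rewrite normrM gtr0_norm // mulrC -ler_pdivlMr.
  rewrite /corner /= p10 p11 /=.
  have := u_ge0 i; have := bu_le1 i; have := mt i; have := b0 i.
  by move=> *; apply/andP; split; nra.
- move=> i p q iJ; rewrite /apart /= => /orP[->//|h]; apply/orP; right.
  rewrite (_ : _ - _ = b i * (p.2 - q.2)); last ring.
  by rewrite normrM gtr0_norm // -(mt i) ler_pM2l.
move=> i j p q iJ jJ ij /andP[_ /andP[p0 p1]] /andP[_ /andP[q0 q1]].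
rewrite /apart /=; apply/orP; right.
have := b0 i; have := b0 j; have := mt i; have := mt j => *.
by case: (b_sep ij) => h; [rewrite distrC|]; apply: le_trans (ler_norm _); nra.
Qed.

Lemma row_covered s t : 1 <= s -> 0 < t <= m^-1 ->
  exists n, covered S s t n /\ n%:R <= K * t `^ (- beta).
Proof.
move=> s1 ht.
suff H t1 t2 : 0 < t1 <= m^-1 -> 0 < t2 <= m^-1 -> t1 = t2 ->
    exists n, covered S s t1 n /\ n%:R <= K * t1 `^ (- beta) by exact: (H t t).
move: t1 t2; apply: (scale_ind m0 rho1 bm bm) => [t1 t2 h1 _ h12 e|t1 t2 h1 _ IH e].
  have t11 : 1 <= t1 by case: h12; rewrite -?e.
  have /andP[_ tm] := h1; have t1m : 1 <= t1 <= m^-1 by rewrite t11.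
  exists 1%N; split; last first.
    have /andP[hK _] := K_between t1m; rewrite mulrC.
    by rewrite -ler_pdivrMr ?mul1r // powR_gt0.
  exists [:: (0, 0)] => // z Sz; exists (0, 0); rewrite ?inE //.
  have [/andP[? ?] /andP[? ?]] := S_sub Sz.
  by rewrite /near_corner /= !subr0 !ger0_norm //; apply/andP; split; lra.
have /andP[t0 _] := h1.
have {}IH i : i \in J -> exists n, covered S s (t1 / b i) n /\
   n%:R <= K * (t1 / b i) `^ (- beta) by move=> iJ; apply: IH => //; rewrite e.
have [n [Fn hn]] := choose_sum_le IH.
exists (\sum_(i in J) n i)%N; split; last first.
  by move: hn; rewrite -mulr_sumr sum_div.
apply: (@covered_sum R S s t1 I J (fun=> s) (fun i => t1 / b i) n
  (fun i p => (0, b i * p.2 + u i))) => //.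
move=> z Sz; have [i [z' [iJ Sz' ez]]] := S_split Sz; exists i, z'; split=> // p.
move=> /andP[_ w2]; apply/andP; split=> /=.
  by have [/andP[? ?] _] := S_sub Sz; rewrite subr0 ger0_norm //; lra.
rewrite ez (_ : _ - _ = b i * (z'.2 - p.2)); last ring.
by rewrite normrM gtr0_norm // mulrC -ler_pdivlMr.
Qed.

(** As [s] lies in [[1, m^-1]], the factor [s^-e] costs only a constant for every exponent [e]; so
    the row count can be compared with a harmonic function of both sides. *)
Lemma row_spread_hfun e s t : 1 <= s <= m^-1 -> 0 < t <= m^-1 ->
  exists n, spread m S s t n /\
    (m `^ (- `|e|))^-1 * (m `^ (- `|beta|))^-1 * hfun e beta s t <= n%:R.
Proof.
move=> hs ht; have [n [Fn hn]] := row_spread hs ht; exists n; split=> //.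
apply: le_trans hn; have := powR_between (- e) m0 hs; rewrite normrN /hfun -/K.
set k := m `^ _; have k0 : 0 < k by apply: powR_gt0.
set y := s `^ _; set x := K^-1 * _ => /andP[_ yk].
have x0 : 0 <= x by rewrite mulr_ge0 ?invr_ge0 ?powR_ge0.
rewrite (_ : _ * _ = k^-1 * y * x); last by rewrite /x; ring.
by rewrite ler_piMl // mulrC ler_pdivrMr // mul1r.
Qed.

Lemma row_covered_hfun e s t : 1 <= s <= m^-1 -> 0 < t <= m^-1 ->
  exists n, covered S s t n /\
    n%:R <= m `^ (- `|e|) * m `^ (- `|beta|) * hfun e beta s t.
Proof.
move=> hs ht; have /andP[s1 _] := hs.
have [n [Fn hn]] := row_covered s1 ht; exists n; split=> //.
apply: (le_trans hn); have := powR_between (- e) m0 hs; rewrite normrN /hfun -/K.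
set k := m `^ _; have k0 : 0 < k by apply: powR_gt0.
set y := s `^ _; set x := K * _ => /andP[ky _].
have x0 : 0 <= x by rewrite mulr_ge0 ?powR_ge0.
rewrite (_ : _ * (y * _) = k * y * x); last by rewrite /x; ring.
by rewrite ler_peMl // mulrC -ler_pdivrMr // div1r.
Qed.

End row_growth.

(** * Counts for the whole carpet *)

Section carpet_growth.
Context {R : realType} (r s : nat).
Variables (a t : 'I_r -> R) (b u : 'I_s -> R) (D : {set 'I_r * 'I_s}).
Variables (S : set (R * R)) (m rho alpha1 alpha2 beta1 beta2 : R).
Hypotheses (m0 : 0 < m) (rho1 : rho < 1).
Hypotheses (am : forall i, m <= a i <= rho) (bm : forall j, m <= b j <= rho).
Hypotheses (t_ge0 : forall i, 0 <= t i) (at_le1 : forall i, a i + t i <= 1).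
Hypotheses (u_ge0 : forall i, 0 <= u i) (bu_le1 : forall i, b i + u i <= 1).
Hypothesis a_sep : forall i j, i != j -> a i + t i <= t j \/ a j + t j <= t i.
Hypothesis b_sep : forall i j, i != j -> b i + u i <= u j \/ b j + u j <= u i.
Hypothesis D_neq0 : D != finset.set0.
Hypothesis S_sub : S `<=` unit_square.
Hypothesis S_neq0 : S !=set0.
Hypothesis S_map : forall d z, d \in D -> S z -> S (baranski_map a t b u d z).
Hypothesis S_split : forall z, S z ->
  exists d z', [/\ d \in D, S z' & z = baranski_map a t b u d z'].
Hypothesis ha1 : \sum_(i in [set d.1 | d in D]%SET) a i `^ alpha1 = 1.
Hypothesis ha2 : \sum_(d in D) a d.1 `^ alpha1 * b d.2 `^ alpha2 = 1.
Hypothesis hb1 : \sum_(j in [set d.2 | d in D]%SET) b j `^ beta1 = 1.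
Hypothesis hb2 : \sum_(d in D) b d.2 `^ beta1 * a d.1 `^ beta2 = 1.

Let a0 i : 0 < a i.
Proof. by have /andP[h _] := am i; apply: lt_le_trans h. Qed.
Let b0 i : 0 < b i.
Proof. by have /andP[h _] := bm i; apply: lt_le_trans h. Qed.
Let a01 i : 0 < a i < 1.
Proof. by rewrite a0; have /andP[_ h] := am i; apply: le_lt_trans h rho1. Qed.
Let b01 i : 0 < b i < 1.
Proof. by rewrite b0; have /andP[_ h] := bm i; apply: le_lt_trans h rho1. Qed.

(** Enlarging [D] to the product of its projections only adds terms, and over the product the sum
    factors into the two one-dimensional sums, both equal to 1. *)
Lemma cross_sum_le1 :
  \sum_(d in D) a d.1 `^ alpha1 * b d.2 `^ beta1 <= 1.
Proof.
pose P1 := [set d.1 | d in D]%SET; pose P2 := [set d.2 | d in D]%SET.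
apply: (@le_trans _ _ (\sum_(d in finset.setX P1 P2) a d.1 `^ alpha1 * b d.2 `^ beta1)).
  rewrite [leRHS](big_setID D) /= (_ : finset.setI _ _ = D); last first.
    apply/finset.setIidPr/fintype.subsetP => d dD; rewrite inE; apply/andP.
    by split; apply/imsetP; exists d.
  by rewrite lerDl; apply: sumr_ge0 => d _; rewrite mulr_ge0 ?powR_ge0.
rewrite [leLHS](_ : _ = (\sum_(i in P1) a i `^ alpha1) * (\sum_(j in P2) b j `^ beta1)).
  by rewrite ha1 hb1 mulr1.
rewrite mulr_suml (eq_bigl (fun d => (d.1 \in P1) && (d.2 \in P2))); last first.
  by move=> d; rewrite inE.
rewrite -(pair_big (fun i => i \in P1) (fun j => j \in P2)
  (fun i j => a i `^ alpha1 * b j `^ beta1)) /=.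
by apply: eq_bigr => i _; rewrite mulr_sumr.
Qed.

(** The cross sum is at most 1, the value taken when [a] has exponent [beta2]. With
    [alpha2_le_beta1] this provides the sign conditions of [moment_lt1]. *)
Lemma beta2_le_alpha1 : beta2 <= alpha1.
Proof.
apply: (@exponent_le R _ D (fun d => a d.1) (fun d => b d.2) beta1 beta2) => //.
by rewrite hb2; under eq_bigr do rewrite mulrC; exact: cross_sum_le1.
Qed.

Lemma alpha2_le_beta1 : alpha2 <= beta1.
Proof.
apply: (@exponent_le R _ D (fun d => b d.2) (fun d => a d.1) alpha1 alpha2) => //.
by rewrite ha2; exact: cross_sum_le1.
Qed.

Lemma spread_baranski x y (n : 'I_r * 'I_s -> nat) : 0 < x -> 0 < y ->
  (forall d, d \in D -> spread m S (x / a d.1) (y / b d.2) (n d)) ->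
  spread m S x y (\sum_(d in D) n d).
Proof.
move=> x0 y0 H.
have ma i : a i * (m * (x / a i)) = m * x.
  by rewrite mulrCA [a i * _]mulrC divfK ?(gt_eqF (a0 i)).
have mb j : b j * (m * (y / b j)) = m * y.
  by rewrite mulrCA [b j * _]mulrC divfK ?(gt_eqF (b0 j)).
apply: (@spread_sum R m S x y _ D (fun d => x / a d.1) (fun d => y / b d.2) n
  (baranski_map a t b u) (baranski_map a t b u)) => //.
- move=> [i j] z p dD Sz /andP[/= w1 w2] /andP[/= /andP[p10 p11] /andP[p20 p21]].
  split; first exact: S_map.
    rewrite /near_corner /baranski_map /affine /=.
    rewrite (_ : _ - _ = a i * (z.1 - p.1)); last ring.
    rewrite (_ : b j * z.2 + _ - _ = b j * (z.2 - p.2)); last ring.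
    by rewrite !normrM (gtr0_norm (a0 i)) (gtr0_norm (b0 j)) (mulrC (a i)) (mulrC (b j))
  -!ler_pdivlMr // w1.
  rewrite /corner /baranski_map /affine /=.
  have := t_ge0 i; have := at_le1 i; have := ma i; have := a0 i.
  have := u_ge0 j; have := bu_le1 j; have := mb j; have := b0 j => *.
  by apply/andP; split; apply/andP; split; nra.
- move=> [i j] p q dD; rewrite /apart /baranski_map /affine /= => h.
  rewrite (_ : a i * p.1 + _ - _ = a i * (p.1 - q.1)); last ring.
  rewrite (_ : b j * p.2 + _ - _ = b j * (p.2 - q.2)); last ring.
  by rewrite !normrM (gtr0_norm (a0 i)) (gtr0_norm (b0 j)) -(ma i) -(mb j) !ler_pM2l.
move=> [i j] [i' j'] p q _ _ ne /andP[/= /andP[p10 p11] /andP[p20 p21]].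
move=> /andP[/= /andP[q10 q11] /andP[q20 q21]].
rewrite /apart /baranski_map /affine /=.
have [e|ni] := eqVneq i i'; apply/orP.
  have nj : j != j' by apply: contraNneq ne => ->; rewrite e.
  right; have := b0 j; have := b0 j'; have := mb j; have := mb j' => *.
  by case: (b_sep nj) => h; [rewrite distrC|]; apply: le_trans (ler_norm _); nra.
left; have := a0 i; have := a0 i'; have := ma i; have := ma i' => *.
by case: (a_sep ni) => h; [rewrite distrC|]; apply: le_trans (ler_norm _); nra.
Qed.

Lemma covered_baranski x y (n : 'I_r * 'I_s -> nat) : 0 < x -> 0 < y ->
  (forall d, d \in D -> covered S (x / a d.1) (y / b d.2) (n d)) ->
  covered S x y (\sum_(d in D) n d).
Proof.
move=> x0 y0 H.
apply: (@covered_sum R S x y _ D (fun d => x / a d.1) (fun d => y / b d.2) n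
  (baranski_map a t b u)) => //.
move=> z Sz; have [[i j] [z' [dD Sz' e]]] := S_split Sz; exists (i, j), z'; split=> // p.
move=> /andP[/= w1 w2]; rewrite e /near_corner /baranski_map /affine /=.
rewrite (_ : _ - _ = a i * (z'.1 - p.1)); last ring.
rewrite (_ : b j * z'.2 + _ - _ = b j * (z'.2 - p.2)); last ring.
by rewrite !normrM (gtr0_norm (a0 i)) (gtr0_norm (b0 j)) (mulrC (a i)) (mulrC (b j))
  -!ler_pdivlMr // w1.
Qed.

(** The constant lost at an exit: one factor for the side in [[1, m^-1]] and one for the
    one-dimensional count. *)
Definition slack (e e' : R) : R := m `^ (- `|e|) * m `^ (- `|e'|).

Lemma slack_gt0 e e' : 0 < slack e e'.
Proof. by rewrite mulr_gt0 ?powR_gt0. Qed.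

Lemma spread_rows x y : 0 < x <= m^-1 -> 0 < y <= m^-1 -> 1 <= x ->
  exists n, spread m S x y n /\
    (slack beta2 beta1)^-1 * hfun beta2 beta1 x y <= n%:R.
Proof.
move=> /andP[_ hx] hy x1; rewrite invfM.
apply: (@row_spread_hfun R _ S [set d.2 | d in D]%SET b u m rho) => //; last by rewrite x1.
move=> j z /imsetP[d dD ->] Sz; exists (baranski_map a t b u d z) => //; exact: S_map.
Qed.

Lemma covered_rows x y : 0 < x <= m^-1 -> 0 < y <= m^-1 -> 1 <= x ->
  exists n, covered S x y n /\
    n%:R <= slack beta2 beta1 * hfun beta2 beta1 x y.
Proof.
move=> /andP[_ hx] hy x1.
apply: (@row_covered_hfun R _ S [set d.2 | d in D]%SET b u m rho) => //; last by rewrite x1.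
move=> z /S_split[d [z' [dD Sz' ->]]]; exists d.2, z'; split=> //.
by apply/imsetP; exists d.
Qed.

Let swap_sub : swap @` S `<=` unit_square.
Proof. by move=> _ [z /S_sub[z1 z2] <-]. Qed.

Let swap_neq0 : swap @` S !=set0.
Proof. by have [z Sz] := S_neq0; exists (swap z), z. Qed.

Lemma spread_columns x y : 0 < x <= m^-1 -> 0 < y <= m^-1 -> 1 <= y ->
  exists n, spread m S x y n /\
    (slack alpha1 alpha2)^-1 * hfun alpha1 alpha2 x y <= n%:R.
Proof.
move=> hx /andP[_ hy] y1.
have [||n [Fn hn]] := @row_spread_hfun R _ (swap @` S) [set d.1 | d in D]%SET a t m rho
  alpha1 m0 rho1 am t_ge0 at_le1 a_sep swap_sub swap_neq0 _ ha1 alpha2 y x _ hx.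
- move=> i _ /imsetP[d dD ->] [z Sz <-].
  exists (swap (baranski_map a t b u d z)) => //.
  by exists (baranski_map a t b u d z) => //; exact: S_map.
- by rewrite y1.
exists n; split; first exact: spread_swap.
by rewrite invfM mulrC hfun_swap mulrC [_^-1 * _^-1]mulrC.
Qed.

Lemma covered_columns x y : 0 < x <= m^-1 -> 0 < y <= m^-1 -> 1 <= y ->
  exists n, covered S x y n /\
    n%:R <= slack alpha1 alpha2 * hfun alpha1 alpha2 x y.
Proof.
move=> hx /andP[_ hy] y1.
have [||n [Fn hn]] := @row_covered_hfun R _ (swap @` S) [set d.1 | d in D]%SET a t m rho
  alpha1 m0 rho1 am swap_sub _ ha1 alpha2 y x _ hx.
- move=> _ [z /S_split[d [z' [dD Sz' ->]]] <-]; exists d.1, (swap z'); split=> //.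
  by apply/imsetP; exists d.
- by rewrite y1.
exists n; split; first exact: covered_swap.
by rewrite /slack hfun_swap [m `^ _ * _]mulrC.
Qed.

Let hA := hfun alpha1 alpha2.
Let hB := hfun beta2 beta1.

Let hb2' : \sum_(d in D) a d.1 `^ beta2 * b d.2 `^ beta1 = 1.
Proof. by under eq_bigr do rewrite mulrC. Qed.

Lemma carpet_covered : exists2 K, 0 < K &
  forall x y, 0 < x <= m^-1 -> 0 < y <= m^-1 ->
    exists n, covered S x y n /\ n%:R <= K * (hA x y + hB x y).
Proof.
exists (Num.max (slack alpha1 alpha2) (slack beta2 beta1)).
  by rewrite lt_max slack_gt0.
have K0 := slack_gt0 alpha1 alpha2; have K0' := slack_gt0 beta2 beta1.
apply: (@growth_le R _ D (fun d => a d.1) (fun d => b d.2) m rho) => //.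
- by move=> x y n x0 y0; apply: covered_baranski.
- by rewrite le_max ltW.
- move=> x y hx hy /(covered_columns hx hy)[n [Fn hn]]; exists n; split=> //.
  apply: (le_trans hn); rewrite ler_wpM2r ?le_max ?lexx //.
  by case/andP: hx => ? _; case/andP: hy => ? _; rewrite ltW // hfun_gt0.
- move=> x y hx hy /(covered_rows hx hy)[n [Fn hn]]; exists n; split=> //.
  apply: (le_trans hn); rewrite ler_wpM2r ?le_max ?lexx ?orbT //.
  by case/andP: hx => ? _; case/andP: hy => ? _; rewrite ltW // hfun_gt0.
Qed.

Lemma carpet_spread_balanced :
  (forall d, d \in D -> a d.1 `^ alpha1 * b d.2 `^ alpha2 =
                         b d.2 `^ beta1 * a d.1 `^ beta2) ->
  exists2 K, 0 < K &
  forall x y, 0 < x <= m^-1 -> 0 < y <= m^-1 -> hA x y = hB x y ->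
    exists n, spread m S x y n /\ K * hA x y <= n%:R.
Proof.
move=> pq; exists (Num.min (slack alpha1 alpha2)^-1 (slack beta2 beta1)^-1).
  by rewrite lt_min !invr_gt0 !slack_gt0.
apply: (@growth_ge_balanced R _ D (fun d => a d.1) (fun d => b d.2) m rho) => //.
- by move=> x y n x0 y0; apply: spread_baranski.
- by move=> d dD; rewrite pq // mulrC.
- move=> x y hx hy /(spread_columns hx hy)[n [Fn hn]]; exists n; split=> //.
  apply: le_trans hn; rewrite ler_wpM2r ?ge_min ?lexx //.
  by case/andP: hx => ? _; case/andP: hy => ? _; rewrite ltW // hfun_gt0.
- move=> x y hx hy /(spread_rows hx hy)[n [Fn hn]]; exists n; split=> //.
  apply: le_trans hn; rewrite ler_wpM2r ?ge_min ?lexx ?orbT //.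
  by case/andP: hx => ? _; case/andP: hy => ? _; rewrite ltW // hfun_gt0.
Qed.

Let half_decay theta eta (x : R) : 0 <= theta < 1 -> 0 < x ->
  exists k, theta ^+ k * x `^ eta <= 2^-1.
Proof.
move=> th x0; have y0 : 0 < x `^ eta by apply: powR_gt0.
have [|k hk] := @exists_expr_lt R theta (2^-1 / x `^ eta) th.
  by rewrite divr_gt0.
by exists k; rewrite -ler_pdivlMr // ltW.
Qed.

(** Only the threshold [e] depends on the ratio [z], not [K]: [z] will be the ratio of height to
    width of a cylinder, and the constant of a box-counting measure must serve all cylinders. *)
Lemma carpet_spread_columns :
  beta1 + beta2 < alpha1 + alpha2 \/ beta1 + beta2 = alpha1 + alpha2 /\
    (exists2 d, d \in D & a d.1 `^ alpha1 * b d.2 `^ alpha2 !=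
                           b d.2 `^ beta1 * a d.1 `^ beta2) ->
  exists2 K, 0 < K & forall z, 0 < z -> exists2 e, 0 < e &
    forall x y, 0 < x <= e -> 0 < y <= e -> x / y = z ->
    exists n, spread m S x y n /\ K * hA x y <= n%:R.
Proof.
move=> hab; have [eta eta0 th1] := @moment_lt1 R _ D (fun d => a d.1) (fun d => b d.2)
  _ _ _ _ (fun d => a01 d.1) (fun d => b01 d.2) ha2 hb2
  beta2_le_alpha1 alpha2_le_beta1 hab.
set theta := \sum_(d in D) _ in th1.
have th0 : 0 <= theta by apply: sumr_ge0 => d _; rewrite mulr_ge0 ?powR_ge0.
have K0 := slack_gt0 alpha1 alpha2.
exists ((slack alpha1 alpha2)^-1 / 2); first by rewrite divr_gt0 ?invr_gt0.
(* [k] is so large that [theta ^+ k * z^eta <= 1/2], which leaves at least half of [hA]; the scale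
   [m ^+ k / m] allows [k] subdivisions. *)
move=> z z0; have [|k hk] := @half_decay theta eta z _ z0; first by rewrite th0.
exists (m ^+ k / m); first by rewrite divr_gt0 ?exprn_gt0.
move=> x y hx hy xyz.
have [||||n [Fn hn]] := @growth_ge_drift R _ D (fun d => a d.1) (fun d => b d.2) m rho
  m0 rho1 _ _ (spread m S) _ alpha1 alpha2 ha2 (spread0 m S)
  (slack alpha1 alpha2)^-1 eta _ eta0 spread_columns (ltW th1) k x y hx hy => //.
- by move=> x' y' n' x0 y0; apply: spread_baranski.
- by rewrite invr_ge0 ltW.
exists n; split=> //; apply: le_trans hn; rewrite xyz -mulrA ler_wpM2l ?invr_ge0 ?(ltW K0) //.
rewrite mulrC ler_wpM2l //; last by rewrite /theta in hk *; lra.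
by case/andP: hx => ? _; case/andP: hy => ? _; rewrite ltW // hfun_gt0.
Qed.

(** The preceding argument with the coordinates exchanged: [growth_ge_drift] is applied to
    [fun y x => spread m S x y]. *)
Lemma carpet_spread_rows :
  alpha1 + alpha2 < beta1 + beta2 \/ alpha1 + alpha2 = beta1 + beta2 /\
    (exists2 d, d \in D & b d.2 `^ beta1 * a d.1 `^ beta2 !=
                           a d.1 `^ alpha1 * b d.2 `^ alpha2) ->
  exists2 K, 0 < K & forall z, 0 < z -> exists2 e, 0 < e &
    forall x y, 0 < x <= e -> 0 < y <= e -> y / x = z ->
    exists n, spread m S x y n /\ K * hB x y <= n%:R.
Proof.
move=> hab; have [eta eta0 th1] := @moment_lt1 R _ D (fun d => b d.2) (fun d => a d.1)
  _ _ _ _ (fun d => b01 d.2) (fun d => a01 d.1) hb2 ha2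
  alpha2_le_beta1 beta2_le_alpha1 hab.
set theta := \sum_(d in D) _ in th1.
have th0 : 0 <= theta by apply: sumr_ge0 => d _; rewrite mulr_ge0 ?powR_ge0.
have K0 := slack_gt0 beta2 beta1.
exists ((slack beta2 beta1)^-1 / 2); first by rewrite divr_gt0 ?invr_gt0.
move=> z z0; have [|k hk] := @half_decay theta eta z _ z0; first by rewrite th0.
exists (m ^+ k / m); first by rewrite divr_gt0 ?exprn_gt0.
move=> x y hx hy xyz.
have [|||||n [Fn hn]] := @growth_ge_drift R _ D (fun d => b d.2) (fun d => a d.1) m rho
  m0 rho1 _ _ (fun y x => spread m S x y) _ beta1 beta2 hb2 (fun y x => spread0 m S x y)
  (slack beta2 beta1)^-1 eta _ eta0 _ (ltW th1) k y x hy hx => //.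
- by move=> x' y' n' x0 y0; apply: spread_baranski.
- by rewrite invr_ge0 ltW.
- by move=> y' x' hy' hx' x1; rewrite hfun_swap; apply: spread_rows.
exists n; split=> //; apply: le_trans hn; rewrite xyz -mulrA ler_wpM2l ?invr_ge0 ?(ltW K0) //.
rewrite /hB hfun_swap mulrC ler_wpM2l //; last by rewrite /theta in hk *; lra.
by case/andP: hx => ? _; case/andP: hy => ? _; rewrite ltW // hfun_gt0.
Qed.

End carpet_growth.

(** * Packing numbers *)

Section packing.
Context {R : realType}.
Implicit Types (X A : set (plane R)) (x y z : plane R) (delta : R).

Lemma euclid_dist_le x y : euclid_dist x y <= `|x.1 - y.1| + `|x.2 - y.2|.
Proof.
rewrite -[leRHS]ger0_norm ?addr_ge0 // -sqrtr_sqr; apply: ler_wsqrtr.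
rewrite [leRHS]sqrrD !real_normK ?num_real // mulr2n.
by have := mulr_ge0 (normr_ge0 (x.1 - y.1)) (normr_ge0 (x.2 - y.2)); lra.
Qed.

Lemma dist_fst_le x y : `|x.1 - y.1| <= euclid_dist x y.
Proof. by rewrite -sqrtr_sqr; apply: ler_wsqrtr; rewrite lerDl sqr_ge0. Qed.

Lemma dist_snd_le x y : `|x.2 - y.2| <= euclid_dist x y.
Proof. by rewrite -sqrtr_sqr; apply: ler_wsqrtr; rewrite lerDr sqr_ge0. Qed.

(** Two centres near the same covering point are at distance at most [delta / 2], so their balls
    meet; hence the assignment of a covering point to each centre is injective. *)
Lemma packing_size_le X A delta n (c : seq (plane R)) : 0 < delta -> A `<=` X ->
  covered A (delta / 8) (delta / 8) n -> packing X delta A c -> (size c <= n)%N.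
Proof.
move=> d0 AX [l <- hl] [uc cA cX].
have /choice[f hf] : forall x, exists p,
    A x -> p \in l /\ near_corner (delta / 8) (delta / 8) x p.
  by move=> x; have [/hl[p pl xp]|nA] := pselect (A x); [exists p | exists (0, 0)].
rewrite -(size_map f) uniq_leq_size //; last first.
  by move=> _ /mapP[x xc ->]; have [] := hf x (cA x xc).
rewrite map_inj_in_uniq // => x y xc yc fxy; apply: contrapT => /eqP xy.
have [_ /andP[x1 x2]] := hf x (cA x xc); have [_ /andP[y1 y2]] := hf y (cA y yc).
have /seteqP[/(_ y) H _] := cX x y xc yc xy; apply: H; split; split.
- rewrite ballEmdist /=; apply: (le_lt_trans (euclid_dist_le x y)).
  rewrite -fxy in y1 y2; move: x1 x2 y1 y2; rewrite !ler_norml.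
  move=> /andP[? ?] /andP[? ?] /andP[? ?] /andP[? ?].
  have : `|x.1 - y.1| <= delta / 4 by rewrite ler_norml; apply/andP; split; lra.
  have : `|x.2 - y.2| <= delta / 4 by rewrite ler_norml; apply/andP; split; lra.
  lra.
- exact/AX/cA.
- exact: ballxx.
- exact/AX/cA.
Qed.

(** The bound [h <= |v - w|] forces different cells of mesh [h]; congruent indices then differ by at
    least [K], so the points are at least [K - 1] meshes apart. *)
Lemma floor_apart (K : nat) (h v w : R) : (0 < K)%N -> 0 < h -> h <= `|v - w| ->
  (Num.floor (v / h) = Num.floor (w / h) %[mod K])%Z ->
  (K%:R - 1) * h <= `|v - w|.
Proof.
move=> K0 h0 hvw /eqP; rewrite eqz_mod_dvd => /dvdzP[q hq].
have /andP[v1 v2] := floor_itv (v / h); have /andP[w1 w2] := floor_itv (w / h).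
set i := Num.floor (v / h) in hq v1 v2; set j := Num.floor (w / h) in hq w1 w2.
rewrite !intrD in v2 w2.
have {}hq : (i%:~R - j%:~R : R) = q%:~R * K%:R.
  by rewrite -intrB hq intrM.
rewrite -[v](divfK (lt0r_neq0 h0)) -[w](divfK (lt0r_neq0 h0)) in hvw *.
set v' := v / h in hvw v1 v2 *; set w' := w / h in hvw w1 w2 *.
rewrite -mulrBl normrM (gtr0_norm h0) in hvw *.
rewrite ler_pM2r //; rewrite -[leLHS]mul1r ler_pM2r // in hvw.
have K1 : 1 <= K%:R :> R by rewrite ler1n.
have [q0|q0|q0] := ltgtP q 0.
- have : (q%:~R : R) <= -1 by rewrite -[-1]/((-1)%:~R) ler_int; lia.
  by move=> ?; rewrite -normrN; apply: le_trans (ler_norm _); nra.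
- have : 1 <= (q%:~R : R) by rewrite -[1]/(1%:~R) ler_int; lia.
  by move=> ?; apply: le_trans (ler_norm _); nra.
move: hq; rewrite q0 mul0r => hq.
by have : `|v' - w'| < 1; [rewrite ltr_norml; apply/andP; split; lra | lra].
Qed.

Lemma pairwise_sym_in (T : eqType) (r : rel T) (c : seq T) : symmetric r ->
  pairwise r c -> {in c &, forall v w, v != w -> r v w}.
Proof.
move=> rs; elim: c => //= z c IH /andP[/allP zc /IH{}IH] x y.
rewrite !inE => /orP[/eqP->|xc] /orP[/eqP->|yc]; first by rewrite eqxx.
- by move=> _; apply: zc.
- by move=> _; rewrite rs; apply: zc.
exact: IH.
Qed.

(* Corners are sorted by the residues modulo [K] of the cell of the grid of mesh
   [m delta] that contains them: distinct corners lie in distinct cells, hence are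
   far apart when their residues agree. *)
Lemma packing_ge X A (K : nat) m delta (l : seq (plane R * plane R)) :
  0 < m -> 0 < delta -> 4 <= (K%:R - 1) * m ->
  (forall e, e \in l -> A e.1 /\ near_corner delta delta e.1 e.2) ->
  pairwise (fun e e' => apart (m * delta) (m * delta) e.2 e'.2) l ->
  exists2 c, packing X delta A c & (size l <= K ^ 2 * size c)%N.
Proof.
move=> m0 d0 hK lA pl.
have K0 : (0 < K)%N by rewrite lt0n; apply: contraTneq hK => ->; rewrite -ltNge; nra.
case: K K0 hK => // K _ hK; set h := m * delta in pl.
have h0 : 0 < h by rewrite mulr_gt0.
pose res (v : R) : 'I_K.+1 := inord `|(Num.floor (v / h) %% K.+1)%Z|%N.
pose cl (e : plane R * plane R) := (res e.2.1, res e.2.2).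
have res_eq v w : res v = res w -> (Num.floor (v / h) = Num.floor (w / h) %[mod K.+1])%Z.
  have lt k : (`|(k %% K.+1)%Z|%N < K.+1)%N.
    by rewrite -ltz_nat gez0_abs ?modz_ge0 // ltz_pmod.
  move=> /(congr1 val); rewrite /= !inordK // => /(congr1 Posz).
  by rewrite !gez0_abs ?modz_ge0.
have cl_far e e' : e \in l -> e' \in l -> cl e = cl e' -> apart h h e.2 e'.2 ->
    2 * delta <= euclid_dist e.1 e'.1.
  move=> /lA[_ /andP[w1 w2]] /lA[_ /andP[w1' w2']] [c1 c2].
  (* By the choice of the modulus, congruent corners are [4 delta] apart in this coordinate; each
     point lies within [delta] of its corner, so the points stay [2 delta] apart. *)
  have D (z p z' p' : R) : res p = res p' -> `|z - p| <= delta -> `|z' - p'| <= delta ->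
      h <= `|p - p'| -> 2 * delta <= `|z - z'|.
    move=> /res_eq rp; rewrite !ler_norml => /andP[? ?] /andP[? ?].
    move=> /floor_apart/(_ rp)=> /(_ isT h0) hp.
    have {}hp : 4 * delta <= `|p - p'|.
      by apply: le_trans hp; rewrite /h mulrA ler_pM2r.
    have [pp|pp] := lerP 0 (p - p').
      by move: hp; rewrite ger0_norm // => hp; apply: le_trans (ler_norm _); lra.
    by move: hp; rewrite ltr0_norm // => hp; rewrite -normrN; apply: le_trans (ler_norm _); lra.
  move=> /orP[a1|a2].
    by apply: le_trans (dist_fst_le _ _); apply: (D _ e.2.1 _ e'.2.1).
  by apply: le_trans (dist_snd_le _ _); apply: (D _ e.2.2 _ e'.2.2).
pose cnt k := count (fun e => cl e == k) l.
(* Pigeonhole: the most populated of the [K.+1 ^ 2] residue classes holds at least the average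
   number of corners. *)
pose k0 := [arg max_(k > (ord0, ord0)) cnt k].
have size_l : (size l <= K.+1 ^ 2 * cnt k0)%N.
  have -> : size l = (\sum_k cnt k)%N.
    rewrite /cnt; elim: (l) => [|e l' IH] /=; first by rewrite big1.
    by rewrite big_split /= -IH (bigD1 (cl e)) //= eqxx big1 // => k;
      rewrite eq_sym => /negbTE ->.
  have -> : (K.+1 ^ 2 * cnt k0 = \sum_(k : 'I_K.+1 * 'I_K.+1) cnt k0)%N.
    by rewrite sum_nat_const card_prod card_ord.
  apply: leq_sum => k _; rewrite /k0; case: arg_maxnP => // i _; exact.
pose c := [seq e.1 | e <- l & cl e == k0].
pose far (x y : plane R) := 2 * delta <= euclid_dist x y.
have pc : pairwise far c.
  rewrite pairwise_map; have := pairwise_filter (fun e => cl e == k0) pl.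
  apply: (@sub_in_pairwise _ [pred e | (cl e == k0) && (e \in l)]) => [e e'|].
    by move=> /andP[/eqP ke el] /andP[/eqP ke' el']; apply: cl_far; rewrite ?ke.
  by apply/allP => e; rewrite mem_filter.
have far_sym : symmetric far by move=> x y; rewrite /far euclid_dist_sym.
exists c; last by rewrite size_map size_filter.
split.
- rewrite uniq_pairwise; apply: sub_pairwise pc => x y; apply: contraTneq => ->.
  by rewrite /far euclid_dist_xx -ltNge mulr_gt0.
- by move=> x /mapP[e]; rewrite mem_filter => /andP[_ /lA[? _]] ->.
move=> x y xc yc xy; apply/seteqP; split=> // z [[+ _] [+ _]].
rewrite !ballEmdist /= => xz yz.
have := pairwise_sym_in far_sym pc xc yc xy; rewrite /far leNgt => /negP[].
apply: (le_lt_trans (euclid_dist_triangle z x y)).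
by rewrite (euclid_dist_sym z) mulr2n mulrDl mul1r ltrD.
Qed.

Lemma packing_has_sup X A delta n : 0 < delta -> A `<=` X ->
  covered A (delta / 8) (delta / 8) n ->
  has_sup ([set (size c)%:R | c in packing X delta A] : set R).
Proof.
move=> d0 AX cA; split; first by exists 0, [::] => //; split.
exists n%:R => _ [c pc <-]; rewrite ler_nat; exact: packing_size_le pc.
Qed.

Lemma packing_number_le X A delta n : 0 < delta -> A `<=` X ->
  covered A (delta / 8) (delta / 8) n -> packing_number X delta A <= n%:R.
Proof.
move=> d0 AX cA; apply: ge_sup; first by have [] := packing_has_sup d0 AX cA.
by move=> _ [c pc <-]; rewrite ler_nat; exact: packing_size_le pc.
Qed.

Lemma packing_number_ge X A (K : nat) m delta n (l : seq (plane R * plane R)) :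
  A `<=` X -> covered A (delta / 8) (delta / 8) n ->
  0 < m -> 0 < delta -> 4 <= (K%:R - 1) * m ->
  (forall e, e \in l -> A e.1 /\ near_corner delta delta e.1 e.2) ->
  pairwise (fun e e' => apart (m * delta) (m * delta) e.2 e'.2) l ->
  (size l)%:R <= K%:R ^+ 2 * packing_number X delta A.
Proof.
move=> AX cA m0 d0 hK lA pl; have [c pc hc] := packing_ge X m0 d0 hK lA pl.
apply: (@le_trans _ _ (K%:R ^+ 2 * (size c)%:R)).
  by rewrite -natrX -natrM ler_nat.
rewrite ler_wpM2l ?exprn_ge0 //.
by apply: sup_upper_bound; [exact: packing_has_sup cA | exists c].
Qed.

End packing.

(** * The attractor and its cylinders *)

Section topology.
Context {R : realType}.

Lemma nonexpansive_continuous (T U : pseudoMetricType R) (f : T -> U) :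
  (forall x y e, ball x e y -> ball (f x) e (f y)) -> continuous f.
Proof.
move=> hf x; apply/cvg_ballP => e e0; apply/nbhs_ballP; exists e => //= y.
exact: hf.
Qed.

Lemma continuous_fst : continuous (fun z : plane R => z.1).
Proof.
apply: nonexpansive_continuous => x y e; rewrite ballEmdist /= => h.
exact: le_lt_trans (dist_fst_le _ _) h.
Qed.

Lemma continuous_snd : continuous (fun z : plane R => z.2).
Proof.
apply: nonexpansive_continuous => x y e; rewrite ballEmdist /= => h.
exact: le_lt_trans (dist_snd_le _ _) h.
Qed.

Lemma finite_lower_bound (I : finType) (f : I -> R) :
  (forall i, 0 < f i) -> exists2 e, 0 < e & forall i, e <= f i.
Proof.
move=> f0; exists (\big[Num.min/1]_i f i); first exact: lt_bigmin.
by move=> i; apply: bigmin_le.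
Qed.

End topology.

(** * Interval maps and coding *)

Section intervals.
Context {R : realType} (n : nat) (a t : 'I_n -> R).
Hypothesis hat : interval_contractions a t.

Lemma interval_slope i : 0 < a i < 1.
Proof. by have [h _ _] := hat. Qed.

Lemma interval_shift_ge0 i : 0 <= t i.
Proof.
have [_ h _] := hat; have /(_ (t i)) := h i.
rewrite /= !in_itv /= => H; have /andP[] // : 0 <= t i <= 1.
by apply: H; exists 0; rewrite /affine /= ?in_itv /= ?lexx ?ler01 // mulr0 add0r.
Qed.

Lemma interval_end_le1 i : a i + t i <= 1.
Proof.
have [_ h _] := hat; have /(_ (a i + t i)) := h i.
rewrite /= !in_itv /= => H; have /andP[] // : 0 <= a i + t i <= 1.
by apply: H; exists 1; rewrite /affine /= ?in_itv /= ?lexx ?ler01 // mulr1.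
Qed.

(** If the intervals overlapped, the later left end [t l] would lie in both half-open images: it is
    the image of 0 under the map [l] and of [(t l - t k) / a k] under the map [k]. *)
Lemma interval_sep i j : i != j -> a i + t i <= t j \/ a j + t j <= t i.
Proof.
suff H k l : k != l -> t k <= t l -> a k + t k <= t l.
  move=> ij; have [tij|tij] := leP (t i) (t j); [left|right]; apply: H => //.
    by rewrite eq_sym.
  exact: ltW.
move=> kl tkl; rewrite leNgt; apply: contra kl => lt; apply/eqP.
have [_ _ /(_ k l I I)] := hat; apply.
have /andP[ak0 _] := interval_slope k; have /andP[al0 _] := interval_slope l.
exists (t l); split.
  exists ((t l - t k) / a k); last by rewrite /affine mulrC divfK ?gt_eqF // subrK.
  rewrite /= in_itv /= divr_ge0 ?subr_ge0 ?(ltW ak0) //= ltr_pdivrMr // mul1r.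
  by rewrite ltrBlDr.
by exists 0; rewrite /affine /= ?in_itv /= ?lexx ?ltr01 // mulr0 add0r.
Qed.

Definition iword (v : seq 'I_n) : R -> R := foldr (fun i g => affine (a i) (t i) \o g) id v.

Lemma iword_itv v x : 0 <= x <= 1 -> 0 <= iword v x <= 1.
Proof.
move=> hx; elim: v => //= i v /andP[h0 h1].
have := interval_shift_ge0 i; have := interval_end_le1 i.
have /andP[? ?] := interval_slope i; rewrite /affine => *.
by apply/andP; split; nra.
Qed.

Lemma iword_gt0 v x : 0 < x -> 0 < iword v x.
Proof.
move=> hx; elim: v => //= i v h0; have := interval_shift_ge0 i.
have /andP[? ?] := interval_slope i; rewrite /affine => ?; nra.
Qed.

Lemma iword_lt1 v x : x < 1 -> iword v x < 1.
Proof.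
move=> hx; elim: v => //= i v h1; have := interval_end_le1 i.
have /andP[? ?] := interval_slope i; rewrite /affine => ?; nra.
Qed.

(** For preimages both below 1, intervals closed on the left only are disjoint; for preimages both
    equal to 1, so are those closed on the right only. Either way the first letters agree, and the
    tails are treated by induction. *)
Lemma iword_inj v w x y : size v = size w -> 0 <= x <= 1 -> 0 <= y <= 1 ->
  (x < 1) = (y < 1) -> iword v x = iword w y -> v = w.
Proof.
move=> + hx hy xy; elim: v w => [|i v IH] [|j w] //= [vw]; rewrite /affine => e.
have [ij|ij] := eqVneq i j; last first.
  have /andP[ai0 _] := interval_slope i; have /andP[aj0 _] := interval_slope j.
  have /andP[v0 v1] := iword_itv v hx; have /andP[w0 w1] := iword_itv w hy.
  have [y1|y1] := ltP y 1.
    have v1' : iword v x < 1 by apply: iword_lt1; rewrite xy.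
    have w1' : iword w y < 1 by apply: iword_lt1.
    move: (iword v x) (iword w y) e v0 w0 v1' w1' => X Y e *.
    by exfalso; case: (interval_sep ij) => *; nra.
  have w1' : 0 < iword w y by apply: iword_gt0; apply: lt_le_trans y1.
  have v1' : 0 < iword v x.
    apply: iword_gt0; apply: (lt_le_trans (ltr01 : 0 < 1 :> R)).
    by move: xy; rewrite [in RHS]ltNge y1 => /negbT; rewrite -leNgt.
  move: (iword v x) (iword w y) e v1 w1 v1' w1' => X Y e *.
  by exfalso; case: (interval_sep ij) => *; nra.
rewrite -ij in e *; congr (_ :: _); apply: IH => //.
have /andP[ai0 _] := interval_slope i.
by move/addIr: e => /(mulfI (lt0r_neq0 ai0)).
Qed.

End intervals.

(** The maximum [M] of [pr] on the compact set is the image of a value at most [M], so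
    [M <= A i * M + T i <= A i * M + 1 - A i] and [M <= 1]; the minimum is treated in the same
    way. *)
Lemma coordinate_itv {R : realType} (I : finType) (D : {set I}) (L : set (plane R))
    (f : I -> plane R -> plane R) (pr : plane R -> R) (A T : I -> R) :
  attractor f D L -> continuous pr ->
  (forall i z, pr (f i z) = A i * pr z + T i) ->
  (forall i, 0 < A i < 1) -> (forall i, 0 <= T i) -> (forall i, A i + T i <= 1) ->
  forall z, L z -> 0 <= pr z <= 1.
Proof.
move=> [L0 Lc LE] prc hpr A01 T0 AT z Lz.
have split_pr y : L y -> exists i y', L y' /\ pr y = A i * pr y' + T i.
  by rewrite {1}LE => -[i iD [y' Ly' <-]]; exists i, y'; rewrite hpr.
have [c /set_mem Lcc cmax] := compact_EVT_max L0 Lc (continuous_subspaceT prc).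
have [d /set_mem Ld dmin] := compact_EVT_min L0 Lc (continuous_subspaceT prc).
have [i [c' [Lc' ec]]] := split_pr c Lcc; have [j [d' [Ld' ed]]] := split_pr d Ld.
have := cmax _ (mem_set Lc'); have := cmax _ (mem_set Lz).
have := dmin _ (mem_set Ld'); have := dmin _ (mem_set Lz).
have /andP[? ?] := A01 i; have /andP[? ?] := A01 j.
have := T0 i; have := T0 j; have := AT i; have := AT j => *.
have : 0 <= pr d by nra.
have : pr c <= 1 by nra.
by move=> ? ?; apply/andP; split; lra.
Qed.

Section word.
Context {R : realType} (n : nat) (a t : 'I_n -> R).

Lemma iword_sub v x y : iword a t v x - iword a t v y = (\prod_(i <- v) a i) * (x - y).
Proof.
elim: v => [|i v IH] /=; first by rewrite big_nil mul1r.
by rewrite big_cons -mulrA -IH /affine; ring.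
Qed.

End word.

(** * Cylinders as a Vitali-type covering *)

Section carpet.
Context {R : realType} (r s : nat).
Variables (a t : 'I_r -> R) (b u : 'I_s -> R) (D : {set 'I_r * 'I_s}).
Variable L : set (plane R).
Hypotheses (hat : interval_contractions a t) (hbu : interval_contractions b u).
Hypothesis D_neq0 : D != finset.set0.
Local Notation f := (baranski_map a t b u).
Hypothesis hL : attractor f D L.

Lemma slope_bounds : exists m rho, [/\ 0 < m, rho < 1,
  forall i, m <= a i <= rho & forall j, m <= b j <= rho].
Proof.
pose sl (k : 'I_r + 'I_s) := match k with inl i => a i | inr j => b j end.
have sl01 k : 0 < sl k < 1 by case: k => ?; apply: interval_slope; eassumption.
have [e e0 he] := @finite_lower_bound R _ (fun k => Num.min (sl k) (1 - sl k)) ltac:(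
  move=> k; have /andP[? ?] := sl01 k; by rewrite lt_min subr_gt0; apply/andP).
have hsl k : e <= sl k <= 1 - e.
  by have := he k; rewrite le_min => /andP[-> ?]; lra.
exists e, (1 - e); split=> //; first lra.
  by move=> i; apply: (hsl (inl i)).
by move=> j; apply: (hsl (inr j)).
Qed.

Lemma attractor_sub : L `<=` unit_square.
Proof.
move=> z Lz; split.
  apply: (@coordinate_itv R _ D L f (fun z => z.1) (fun d => a d.1) (fun d => t d.1)) => //.
  - exact: continuous_fst.
  - by move=> d; apply: interval_slope hat _.
  - by move=> d; apply: interval_shift_ge0 hat _.
  - by move=> d; apply: interval_end_le1 hat _.
apply: (@coordinate_itv R _ D L f (fun z => z.2) (fun d => b d.2) (fun d => u d.2)) => //.
- exact: continuous_snd.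
- by move=> d; apply: interval_slope hbu _.
- by move=> d; apply: interval_shift_ge0 hbu _.
- by move=> d; apply: interval_end_le1 hbu _.
Qed.

Lemma attractor_map d z : d \in D -> L z -> L (f d z).
Proof. by move=> dD Lz; have [_ _ ->] := hL; exists d => //; exists z. Qed.

Lemma attractor_split z : L z -> exists d z', [/\ d \in D, L z' & z = f d z'].
Proof.
by have [_ _ {1}->] := hL => -[d dD [z' Lz' <-]]; exists d, z'.
Qed.

Lemma word_mapE w z : word_map f w z =
  (iword a t [seq d.1 | d <- w] z.1, iword b u [seq d.2 | d <- w] z.2).
Proof. by elim: w => [|d w IH] /=; [case: z | rewrite IH]. Qed.

Lemma word_map_in w z : {subset w <= D} -> L z -> L (word_map f w z).
Proof.
elim: w => //= d w IH wD Lz; apply: attractor_map; first by rewrite wD ?mem_head.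
by apply: IH => // e ew; apply: wD; rewrite inE ew orbT.
Qed.

Lemma word_map_split k z : L z ->
  exists w z', [/\ size w = k, {subset w <= D}, L z' & z = word_map f w z'].
Proof.
elim: k z => [|k IH] z Lz; first by exists [::], z.
have [d [z' [dD /IH[w [z'' [wk wD Lz'' ->]]] ->]]] := attractor_split Lz.
exists (d :: w), z''; split=> //=; first by rewrite wk.
by move=> e; rewrite inE => /orP[/eqP->//|/wD].
Qed.

Lemma baranski_map_continuous d : continuous (f d).
Proof.
apply: nonexpansive_continuous => x y e; rewrite !ballEmdist /=; apply: le_lt_trans.
have /andP[a0 a1] := interval_slope hat d.1; have /andP[b0 b1] := interval_slope hbu d.2.
rewrite /mdist /= /euclid_dist; apply: ler_wsqrtr; rewrite /baranski_map /affine /=.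
rewrite (_ : _ - _ = a d.1 * (x.1 - y.1)); last ring.
rewrite (_ : b d.2 * x.2 + _ - _ = b d.2 * (x.2 - y.2)); last ring.
rewrite !exprMn lerD // ler_piMl ?sqr_ge0 // expr_le1 // ltW //.
Qed.

Lemma word_map_continuous w : continuous (word_map f w).
Proof.
elim: w => [|d w IH]; first by move=> x; exact: cvg_id.
by move=> x; apply: continuous_comp; [exact: IH | exact: baranski_map_continuous].
Qed.

Lemma cylinder_compact w : compact (word_map f w @` L).
Proof.
have [_ Lc _] := hL; apply: continuous_compact => //.
by apply: continuous_subspaceT; exact: word_map_continuous.
Qed.

Lemma cylinders_cover k : \bigcup_(A in cylinders f D L k) A = L.
Proof.
apply/seteqP; split=> z.
  by move=> [_ [w [_ wD] <-] [z' Lz' <-]]; apply: word_map_in.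
move=> /(word_map_split k)[w [z' [wk wD Lz' ->]]].
by exists (word_map f w @` L); [exists w | exists z'].
Qed.

(** A point on a common boundary may belong to several cylinders. By [iword_inj], a cylinder
    containing [x] is determined by whether each coordinate of a chosen preimage of [x] is below 1,
    which leaves four cases. *)
Lemma cylinders_multiplicity k x :
  ([set A | cylinders f D L k A /\ A x] #<= `I_4)%card.
Proof.
have /choice[g hg] : forall A : set (plane R), exists wz : seq ('I_r * 'I_s) * plane R,
    cylinders f D L k A /\ A x ->
    [/\ word_map f wz.1 @` L = A, size wz.1 = k, L wz.2 & word_map f wz.1 wz.2 = x].
  move=> A; have [[[w [wk wD] wA] Ax]|?] := pselect (cylinders f D L k A /\ A x); last first.
    by exists ([::], point).
  by rewrite -wA in Ax; case: Ax => z Lz zx; exists (w, z).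
pose code A := (nat_of_bool ((g A).2.1 < 1)%R + (nat_of_bool ((g A).2.2 < 1)%R).*2)%N.
apply/pcard_leP/injfunPex; exists code.
  by move=> A _; rewrite /code /=; case: (_ < 1); case: (_ < 1).
move=> A B /set_mem/hg[gA sA LA xA] /set_mem/hg[gB sB LB xB] cAB.
suff e : (g A).1 = (g B).1 by rewrite -gA -gB e.
have c1 : ((g A).2.1 < 1) = ((g B).2.1 < 1).
  by move: cAB; rewrite /code; do 4!case: (_ < 1).
have c2 : ((g A).2.2 < 1) = ((g B).2.2 < 1).
  by move: cAB; rewrite /code; do 4!case: (_ < 1).
have [A1 A2] := attractor_sub LA; have [B1 B2] := attractor_sub LB.
move: xA; rewrite -xB !word_mapE => -[e1 e2].
have szE (T : Type) (h : 'I_r * 'I_s -> T) : size (map h (g A).1) = size (map h (g B).1).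
  by rewrite !size_map sA sB.
have m1 := iword_inj hat (szE _ _) A1 B1 c1 e1.
have m2 := iword_inj hbu (szE _ _) A2 B2 c2 e2.
have zipE (w : seq ('I_r * 'I_s)) : w = zip (map fst w) (map snd w).
  by elim: w => //= -[i j] w {1}->.
by rewrite [LHS]zipE m1 m2 -zipE.
Qed.

Lemma prod_slope_le (n : nat) (c : 'I_n -> R) rho v : (forall i, 0 < c i <= rho) ->
  0 < \prod_(i <- v) c i <= rho ^+ size v.
Proof.
move=> hc; elim: v => [|i v /andP[h0 h1]] /=; first by rewrite big_nil expr0 ltr01 lexx.
rewrite big_cons exprS; have /andP[c0 c1] := hc i.
by rewrite mulr_gt0 //= ler_pM // ltW.
Qed.

Lemma cylinders_diam :
  (fun k => sup [set diam A | A in cylinders f D L k]) @ \oo --> (0 : R).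
Proof.
have [m [rho [m0 rho1 am bm]]] := slope_bounds.
have [[d0 d0D] rho0] : (exists d, d \in D) /\ 0 < rho.
  have /finset.set0Pn[d dD] := D_neq0; split; first by exists d.
  by have /andP[h1 h2] := am d.1; lra.
have cyl_diam k w : size w = k -> 0 <= diam (word_map f w @` L) <= 2 * rho ^+ k.
  move=> wk; have [z0 Lz0] : L !=set0 by have [] := hL.
  have ub p : (word_map f w @` L `*` word_map f w @` L) p -> mdist p.1 p.2 <= 2 * rho ^+ k.
    move=> [[x Lx <-] [y Ly <-]]; apply: (le_trans (euclid_dist_le _ _)).
    rewrite !word_mapE /= !iword_sub !normrM.
    have := attractor_sub Lx => -[/andP[? ?] /andP[? ?]].
    have := attractor_sub Ly => -[/andP[? ?] /andP[? ?]].
    have x1 : `|x.1 - y.1| <= 1 by rewrite ler_norml; apply/andP; split; lra.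
    have x2 : `|x.2 - y.2| <= 1 by rewrite ler_norml; apply/andP; split; lra.
    have bnd (n : nat) (c : 'I_n -> R) (v : seq 'I_n) (y0 : R) :
        (forall i, m <= c i <= rho) -> size v = k -> `|y0| <= 1 ->
        `|\prod_(i <- v) c i| * `|y0| <= rho ^+ k.
      move=> hc vk hy; have [|c0 c1] := andP (@prod_slope_le _ c rho v _).
        by move=> i; have /andP[h1 h2] := hc i; rewrite h2 andbT (lt_le_trans m0).
      rewrite vk in c1; rewrite (ger0_norm (ltW c0)).
      by apply: le_trans c1; rewrite ler_piMr // (ltW c0).
    by rewrite mulr2n mulrDl mul1r lerD //; apply: bnd; rewrite ?size_map.
  rewrite /diam; set diams := (X in sup X).
  have z0_diams : diams (mdist (word_map f w z0) (word_map f w z0)).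
    by exists (word_map f w z0, word_map f w z0) => //; split; exists z0.
  have ub_diams : ubound diams (2 * rho ^+ k) by move=> _ [p /ub hp <-].
  have sup_diams : has_sup diams by split; [eexists; exact: z0_diams | eexists; exact: ub_diams].
  apply/andP; split; last by apply: ge_sup => //; have [] := sup_diams.
  by apply: le_trans (sup_upper_bound sup_diams z0_diams); exact: mdist_ge0.
have lim0 : (fun k => 2 * rho ^+ k) @ \oo --> (0 : R).
  rewrite -[X in _ --> X](mulr0 2); apply: cvgMr; apply: cvg_expr.
  by rewrite ger0_norm // ltW.
suff H : \forall k \near \oo,
    (0 : R) <= sup [set diam A | A in cylinders f D L k] <= 2 * rho ^+ k.
  by apply: (squeeze_cvgr H _ lim0); exact: cvg_cst.
apply: nearW => k; set diams := (X in sup X); pose w0 := nseq k d0.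
have w0_diams : diams (diam (word_map f w0 @` L)).
  exists (word_map f w0 @` L) => //; exists w0 => //.
  by split; [rewrite size_nseq | move=> e /nseqP[->]].
have ub_diams : ubound diams (2 * rho ^+ k).
  by move=> _ [_ [w [wk wD] <-] <-]; have /andP[] := cyl_diam k w wk.
have sup_diams : has_sup diams by split; [eexists; exact: w0_diams | eexists; exact: ub_diams].
apply/andP; split; last by apply: ge_sup => //; have [] := sup_diams.
apply: le_trans (sup_upper_bound sup_diams w0_diams).
by have /andP[] := cyl_diam k w0 (size_nseq _ _).
Qed.

Lemma carpet_vitali_covering : vitali_covering L (cylinders f D L).
Proof.
split.
- by move=> k _; exact: cylinders_cover.
- by move=> k A _ [w _ <-]; exact: cylinder_compact.
- by exists 4%N => k x _ _; exact: cylinders_multiplicity.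
- exact: cylinders_diam.
Qed.

End carpet.

(** * Bernoulli measures of cylinders *)

Section bernoulli.
Context {R : realType} {I : finType} {T : pmetricType R}.
Variables (f : I -> T -> T) (D : {set I}) (L : set T) (p : I -> R).
Variable mu : probability (borel T) R.
Hypothesis hmu : bernoulli_measure f D L p mu.
Hypothesis L_closed : closed L.
Hypothesis f_cont : forall i, continuous (f i).
Hypothesis p_gt0 : forall i, i \in D -> 0 < p i.
Hypothesis p_sum : \sum_(i in D) p i = 1.

Lemma closed_borel (E : set T) : closed E -> measurable (E : set (borel T)).
Proof.
move=> cE; rewrite -[E]setCK; apply: measurableC; apply: sub_sigma_algebra.
exact: closed_openC.
Qed.

Lemma closed_preimage i (E : set T) : closed E -> closed (f i @^-1` E).
Proof. by move=> cE; apply: closed_comp => // x _; exact: f_cont. Qed.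

Lemma bernoulli_setC : mu (~` L) = 0%E.
Proof.
rewrite probability_setC; last exact: closed_borel.
by have [-> _] := hmu; rewrite subee.
Qed.

Lemma bernoulli_null_sub (E N : set (borel T)) :
  closed (E : set T) -> closed (N : set T) -> mu N = 0%E ->
  E `&` L `<=` N -> mu E = 0%E.
Proof.
move=> cE cN N0 EN; apply/eqP; rewrite eq_le measure_ge0 andbT.
have mL : measurable (~` L : set (borel T)) by apply: measurableC; exact: closed_borel.
apply: (@le_trans _ _ (mu (N `|` ~` L))).
  apply: le_measure; rewrite ?inE; [exact: closed_borel| |].
    by apply: measurableU => //; exact: closed_borel.
  by move=> x Ex; have [Lx|nLx] := pselect (L x); [left; apply: EN | right].
apply: (le_trans (measureU2 mu (closed_borel cN) mL)).
by rewrite [X in (X + _)%E]N0 [X in (_ + X)%E]bernoulli_setC adde0.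
Qed.

(** In the invariance relation each term is at most [p i * mu E] and the term of [i0] vanishes.
    Hence [mu E <= (1 - p i0) * mu E], which forces [mu E = 0]. *)
Lemma bernoulli_null (E : set (borel T)) i0 : closed (E : set T) -> i0 \in D ->
  (forall i, i \in D -> f i @^-1` E `&` L `<=` E) ->
  f i0 @^-1` E `&` L = set0 -> mu E = 0%E.
Proof.
move=> cE i0D fE fE0.
have fin (F : set (borel T)) : closed (F : set T) -> mu F \is a fin_num.
  by move=> cF; apply: fin_num_measure; exact: closed_borel.
have [_ /(_ E (closed_borel cE))] := hmu.
have mE_le i : i \in D -> (mu (f i @^-1` E) <= mu E)%E.
  move=> iD; rewrite -[leLHS]adde0.
  have mfE := closed_borel (closed_preimage (i := i) cE).
  have mL : measurable (~` L : set (borel T)) by apply: measurableC; exact: closed_borel.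
  apply: (@le_trans _ _ (mu (E `|` ~` L))); last first.
    apply: (le_trans (measureU2 mu (closed_borel cE) mL)).
    by rewrite [X in (_ + X)%E]bernoulli_setC adde0.
  rewrite adde0; apply: le_measure; rewrite ?inE => //.
    by apply: measurableU => //; exact: closed_borel.
  by move=> x Ex; have [Lx|nLx] := pselect (L x); [left; apply: (fE i) | right].
have E0 : mu (f i0 @^-1` E) = 0%E.
  apply: (@bernoulli_null_sub _ set0) => //; [exact: closed_preimage | exact: closed0 |].
  by rewrite fE0.
rewrite (bigD1 i0) //= E0 mule0 add0e => h.
have /fineK hE := fin E cE; move: h mE_le; rewrite -hE; set M := fine (mu E) => h mE_le.
have M0 : 0 <= M by apply: fine_ge0.
have : (M%:E <= \sum_(i in D | i != i0) (p i)%:E * M%:E)%E.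
  rewrite [leLHS]h; apply: lee_sum => i /andP[iD _].
  by rewrite lee_pmul2l ?lte_fin ?p_gt0 // mE_le.
under eq_bigr do rewrite -EFinM; rewrite sumEFin lee_fin -mulr_suml => hM.
have := p_gt0 i0D; move: p_sum; rewrite (bigD1 i0) //=.
set S := \sum_(i in D | _) _ in hM * => hS p0.
by congr (_%:E); nra.
Qed.

End bernoulli.

(** * Masses of cylinders *)

Section cylinder_measure.
Context {R : realType} (r s : nat).
Variables (a t : 'I_r -> R) (b u : 'I_s -> R) (D : {set 'I_r * 'I_s}).
Variable L : set (plane R).
Hypotheses (hat : interval_contractions a t) (hbu : interval_contractions b u).
Local Notation f := (baranski_map a t b u).
Hypothesis hL : attractor f D L.
Variables (p : 'I_r * 'I_s -> R) (mu : probability (borel (plane R)) R).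
Hypothesis hmu : bernoulli_measure f D L p mu.
Hypothesis p_gt0 : forall d, d \in D -> 0 < p d.
Hypothesis p_sum : \sum_(d in D) p d = 1.

Let f_cont d : continuous (f d).
Proof. exact: baranski_map_continuous. Qed.

Let L_closed : closed L.
Proof. by have [_ Lc _] := hL; apply: compact_closed => //; exact: metric_hausdorff. Qed.

Let L_sub := attractor_sub hat hbu hL.

(** With separated intervals the line [pr = 0] misses the piece of [d1] and [pr = 1] misses the
    piece of [d0], while the preimages in [L] of either line lie on that line; so [bernoulli_null]
    applies to both. *)
Lemma coordinate_boundary_null (pr : plane R -> R) (A T : 'I_r * 'I_s -> R) d0 d1 :
  continuous pr -> (forall d z, pr (f d z) = A d * pr z + T d) ->
  (forall d, 0 < A d < 1) -> (forall d, 0 <= T d) -> (forall d, A d + T d <= 1) ->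
  d0 \in D -> d1 \in D -> A d0 + T d0 <= T d1 ->
  mu [set z | pr z = 0 \/ pr z = 1] = 0%E.
Proof.
move=> prc hpr A01 T0 AT d0D d1D d01.
have prL z : L z -> 0 <= pr z <= 1 by apply: (coordinate_itv hL prc hpr A01 T0 AT).
have cl c : closed [set z | pr z = c].
  by apply: (closed_comp (D := [set c])) => // x _; exact: prc.
have null c d : (c = 0 \/ c = 1) -> d \in D ->
    (forall e z, e \in D -> L z -> A e * pr z + T e = c -> pr z = c) ->
    (forall z, L z -> A d * pr z + T d <> c) -> mu [set z | pr z = c] = 0%E.
  move=> hc dD h1 h2; apply: (bernoulli_null hmu _ _ _ _ _ dD) => //.
    by move=> e eD z [/= + Lz]; rewrite hpr; exact: h1.
  by apply/seteqP; split => // z [/= + Lz]; rewrite hpr; exact: h2.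
have [A00 _] := andP (A01 d0); have [A10 _] := andP (A01 d1).
have null0 : mu [set z | pr z = 0] = 0%E.
  apply: (null 0 d1) => //; first by left.
    move=> e z _ /prL/andP[z0 _]; have [Ae _] := andP (A01 e); have := T0 e => ? ?; nra.
  by move=> z /prL/andP[z0 _]; have := T0 d0 => ? ?; nra.
have null1 : mu [set z | pr z = 1] = 0%E.
  apply: (null 1 d0) => //; first by right.
    move=> e z _ /prL/andP[_ z1]; have [Ae _] := andP (A01 e); have := AT e => ? ?; nra.
  by move=> z /prL/andP[_ z1]; have := AT d1 => ? ?; nra.
have -> : [set z | pr z = 0 \/ pr z = 1] = [set z | pr z = 0] `|` [set z | pr z = 1] by [].
apply/eqP; rewrite eq_le measure_ge0 andbT.
apply: (le_trans (measureU2 mu (closed_borel (cl 0)) (closed_borel (cl 1)))).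
by rewrite [X in (X + _)%E]null0 [X in (_ + X)%E]null1 adde0.
Qed.

Let cyl_closed w : closed (word_map f w @` L).
Proof.
by apply: compact_closed; [exact: metric_hausdorff | exact: (cylinder_compact hat hbu hL)].
Qed.

Let endpoint (n : nat) (c v : 'I_n -> R) i j x y : interval_contractions c v -> i != j ->
  0 <= x <= 1 -> 0 <= y <= 1 -> affine (c i) (v i) x = affine (c j) (v j) y ->
  x = 0 \/ x = 1.
Proof.
move=> hcv ij /andP[x0 x1] /andP[y0 y1]; rewrite /affine => e.
have /andP[ci _] := interval_slope hcv i; have /andP[cj _] := interval_slope hcv j.
by case: (interval_sep hcv ij) => h; [right|left]; nra.
Qed.

Let boundary_null d0 d1 : d0 \in D -> d1 \in D -> d0.1 != d1.1 ->
  mu [set z | z.1 = 0 \/ z.1 = 1] = 0%E.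
Proof.
move=> d0D d1D ne; have hA d : 0 < a d < 1 := interval_slope hat d.
have hT := interval_shift_ge0 hat; have hAT := interval_end_le1 hat.
by case: (interval_sep hat ne) => h;
  [apply: (@coordinate_boundary_null (fun z => z.1) (fun d => a d.1) (fun d => t d.1) d0 d1)
  |apply: (@coordinate_boundary_null (fun z => z.1) (fun d => a d.1) (fun d => t d.1) d1 d0)];
  rewrite //; exact: continuous_fst.
Qed.

Let boundary_null' d0 d1 : d0 \in D -> d1 \in D -> d0.2 != d1.2 ->
  mu [set z | z.2 = 0 \/ z.2 = 1] = 0%E.
Proof.
move=> d0D d1D ne; have hA d : 0 < b d < 1 := interval_slope hbu d.
have hT := interval_shift_ge0 hbu; have hAT := interval_end_le1 hbu.
by case: (interval_sep hbu ne) => h;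
  [apply: (@coordinate_boundary_null (fun z => z.2) (fun d => b d.2) (fun d => u d.2) d0 d1)
  |apply: (@coordinate_boundary_null (fun z => z.2) (fun d => b d.2) (fun d => u d.2) d1 d0)];
  rewrite //; exact: continuous_snd.
Qed.

Let boundary_closed (pr : plane R -> R) : continuous pr ->
  closed [set z | pr z = 0 \/ pr z = 1].
Proof.
move=> prc; have cl c : closed [set z | pr z = c].
  by apply: (closed_comp (D := [set c])) => // x _; exact: prc.
exact: closedU (cl 0) (cl 1).
Qed.

(** By induction on the word, the invariance relation contributes [p d] times the mass of the
    shorter cylinder. Every other term is null, because a point of [L] sent by [e] into the piece of
    [d] has a coordinate equal to 0 or 1. *)
Lemma bernoulli_cylinder w : {subset w <= D} ->
  mu (word_map f w @` L) = (\prod_(d <- w) p d)%:E.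
Proof.
elim: w => [|d w IH] wD.
  by rewrite big_nil image_id; have [] := hmu.
have dD : d \in D by rewrite wD ?mem_head.
have wD' : {subset w <= D} by move=> e ew; apply: wD; rewrite inE ew orbT.
have {}IH := IH wD'.
have [_ /(_ _ (closed_borel (@cyl_closed (d :: w))))] := hmu.
rewrite (bigD1 d) //= big1 ?adde0 => [->|e /andP[eD ed]].
  rewrite big_cons EFinM -IH; congr (_ * mu _)%E.
  have [a0 _] := andP (interval_slope hat d.1); have [b0 _] := andP (interval_slope hbu d.2).
  apply/seteqP; split=> z /=.
    move=> [y Ly]; rewrite [in X in X -> _]/baranski_map /affine /= => -[e1 e2]; exists y => //.
    case: z e1 e2 => z1 z2 /= /addIr/(mulfI (lt0r_neq0 a0)) e1 /addIr/(mulfI (lt0r_neq0 b0)) e2.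
    by case: (word_map f w y) e1 e2 => ? ? /= -> ->.
  by move=> [y Ly <-]; exists y.
rewrite (_ : mu _ = 0%E) ?mule0 //.
have cE := closed_preimage f_cont (i := e) (@cyl_closed (d :: w)).
have img z : L z -> (f e @^-1` (word_map f (d :: w) @` L)) z ->
    exists2 y, L y & f d y = f e z.
  move=> Lz [y Ly /= fy]; exists (word_map f w y) => //.
  exact: (word_map_in hL).
(* The coordinate used is one in which [e] and [d] differ: two separated maps in that coordinate
   make its boundary lines null. *)
have [ne|ne] := eqVneq e.1 d.1.
  have ne2 : e.2 != d.2.
    by apply: contraNneq ed => ne2; rewrite [e]surjective_pairing ne ne2 -surjective_pairing.
  apply: (bernoulli_null_sub hmu L_closed cE (boundary_closed continuous_snd)).
    exact: (boundary_null' eD dD).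
  move=> z [/img + Lz] => /(_ Lz)[y Ly [_ /esym e2]].
  have [_ z2] := L_sub Lz; have [_ y2] := L_sub Ly.
  exact: endpoint hbu ne2 z2 y2 e2.
apply: (bernoulli_null_sub hmu L_closed cE (boundary_closed continuous_fst)).
  exact: (boundary_null eD dD).
move=> z [/img + Lz] => /(_ Lz)[y Ly [/esym e1 _]].
have [z1 _] := L_sub Lz; have [y1 _] := L_sub Ly.
exact: endpoint hat ne z1 y1 e1.
Qed.

End cylinder_measure.

(** * Box-counting estimates *)

Section real_bounds.
Context {R : realType}.

(** The larger exponent wins as [d] tends to 0. The masses [P] and [Q] affect only the threshold
    [d0], so the constants serve all cylinders. *)
Lemma dominant_bounds (e1 e2 : R) (N : R -> R) (P Q C c d1 : R) :
  e2 < e1 -> 0 < P -> 0 < Q -> 0 < C -> 0 < d1 ->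
  (forall d, 0 < d <= d1 -> N d <= C * (d `^ (- e1) * P + d `^ (- e2) * Q)) ->
  (forall d, 0 < d <= d1 -> c * (d `^ (- e1) * P) <= N d) ->
  exists2 d0, 0 < d0 & forall d, 0 < d <= d0 ->
    c * P <= N d * d `^ e1 <= 2 * C * P.
Proof.
move=> e12 P0 Q0 C0 d10 hU hL; have e0 : 0 < e1 - e2 by rewrite subr_gt0.
(* The solution of [d^(e1 - e2) * Q = P]; below it the second term is at most the first. *)
pose d2 := (P / Q) `^ (e1 - e2)^-1.
have d20 : 0 < d2 by rewrite powR_gt0 ?divr_gt0.
exists (Num.min d1 d2); first by rewrite lt_min d10.
move=> d /andP[d0]; rewrite le_min => /andP[dd1 dd2].
have hd : 0 < d <= d1 by rewrite d0.
have p1 : 0 < d `^ e1 by apply: powR_gt0.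
have inv1 : d `^ (- e1) * d `^ e1 = 1 by rewrite -powRDr // addNr powRr0.
have hQ : d `^ (e1 - e2) * Q <= P.
  rewrite -ler_pdivlMr // (_ : P / Q = d2 `^ (e1 - e2)).
    by apply: ge0_ler_powR; rewrite ?nnegrE // ltW.
  by rewrite /d2 -powRrM mulVf ?gt_eqF // powRr1 // ltW // divr_gt0.
have hQ2 : d `^ (- e2) * d `^ e1 = d `^ (e1 - e2) by rewrite -powRDr // addrC.
apply/andP; split.
  have := hL d hd; rewrite -(ler_pM2r p1); apply: le_trans.
  by rewrite -!mulrA [P * _]mulrC [_ `^ _ * (_ * P)]mulrA inv1 mul1r.
have := hU d hd; rewrite -(ler_pM2r p1) => /le_trans; apply.
rewrite [leLHS](_ : _ = C * ((d `^ (- e1) * d `^ e1) * P + (d `^ (- e2) * d `^ e1) * Q)); last ring.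
rewrite inv1 hQ2 mul1r; nra.
Qed.

(** [ln (N d) + gamma * ln d] stays bounded, so it is negligible against [- ln d]. *)
Lemma cvg_log_ratio (N : R -> R) (gamma c C d0 : R) :
  0 < c -> 0 < d0 ->
  (forall d, 0 < d <= d0 -> c <= N d * d `^ gamma <= C) ->
  (fun d : R => ln (N d) / - ln d) @ 0^'+ --> gamma.
Proof.
move=> c0 d00 h; have C0 : 0 < C.
  by have /andP[h1 h2] := h d0 ltac:(by rewrite d00 lexx); apply: lt_le_trans c0 (le_trans h1 h2).
pose K := `|ln c| + `|ln C| + 1.
have K0 : 0 < K by rewrite /K; have := normr_ge0 (ln c); have := normr_ge0 (ln C); lra.
apply/cvgrPdist_lt => e e0; near=> d.
have dpos : 0 < d by near: d; exact: nbhs_right_gt.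
have dd0 : d <= d0 by near: d; exact: nbhs_right_le.
have dK : d < expR (- (K / e)) by near: d; apply: nbhs_right_lt; exact: expR_gt0.
have lnd : ln d < - (K / e) by rewrite -ltr_expR lnK.
have /andP[h1 h2] := h d ltac:(by rewrite dpos).
have pd : 0 < d `^ gamma by apply: powR_gt0.
have Nd : 0 < N d by rewrite -(pmulr_lgt0 _ pd); apply: lt_le_trans h1.
have l1 : ln c <= ln (N d) + gamma * ln d.
  by rewrite -ln_powR -lnM ?posrE // ler_ln ?posrE // mulr_gt0.
have l2 : ln (N d) + gamma * ln d <= ln C.
  by rewrite -ln_powR -lnM ?posrE // ler_ln ?posrE // mulr_gt0.
have KeM : K < e * (- ln d).
  have : K / e < - ln d by lra.
  by rewrite ltr_pdivrMr // mulrC.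
have nld : 0 < - ln d.
  by rewrite oppr_gt0; apply: (lt_trans lnd); rewrite oppr_lt0 divr_gt0.
rewrite (_ : gamma - _ = - ((ln (N d) + gamma * ln d) / (- ln d))); last first.
  by field; rewrite lt_eqF //; lra.
rewrite normrN normrM normfV (gtr0_norm nld) ltr_pdivrMr //.
apply: le_lt_trans KeM; rewrite /K ler_norml.
have := ler_norm (ln C); have := ler_norm (- ln c); rewrite normrN.
have := normr_ge0 (ln c); have := normr_ge0 (ln C) => *.
by apply/andP; split; lra.
Unshelve. all: end_near. Qed.

End real_bounds.

(** * Packing numbers of cylinders *)

Section cylinder_counting.
Context {R : realType} (r s : nat).
Variables (a t : 'I_r -> R) (b u : 'I_s -> R) (D : {set 'I_r * 'I_s}).
Variables (L : set (plane R)) (alpha1 alpha2 beta1 beta2 : R).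
Hypotheses (hat : interval_contractions a t) (hbu : interval_contractions b u).
Hypothesis D_neq0 : D != finset.set0.
Local Notation f := (baranski_map a t b u).
Hypothesis hL : attractor f D L.
Hypothesis ha1 : \sum_(i in [set d.1 | d in D]%SET) a i `^ alpha1 = 1.
Hypothesis ha2 : \sum_(d in D) a d.1 `^ alpha1 * b d.2 `^ alpha2 = 1.
Hypothesis hb1 : \sum_(j in [set d.2 | d in D]%SET) b j `^ beta1 = 1.
Hypothesis hb2 : \sum_(d in D) b d.2 `^ beta1 * a d.1 `^ beta2 = 1.

Let a0 i : 0 < a i. Proof. by have /andP[] := interval_slope hat i. Qed.
Let b0 j : 0 < b j. Proof. by have /andP[] := interval_slope hbu j. Qed.

Definition width (w : seq ('I_r * 'I_s)) : R := \prod_(i <- [seq d.1 | d <- w]) a i.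
Definition height (w : seq ('I_r * 'I_s)) : R := \prod_(j <- [seq d.2 | d <- w]) b j.
Definition weightA (w : seq ('I_r * 'I_s)) : R :=
  \prod_(d <- w) (a d.1 `^ alpha1 * b d.2 `^ alpha2).
Definition weightB (w : seq ('I_r * 'I_s)) : R :=
  \prod_(d <- w) (b d.2 `^ beta1 * a d.1 `^ beta2).

Lemma width_gt0 w : 0 < width w. Proof. by rewrite prodr_gt0. Qed.
Lemma height_gt0 w : 0 < height w. Proof. by rewrite prodr_gt0. Qed.

Lemma weightA_gt0 w : 0 < weightA w.
Proof. by rewrite prodr_gt0 // => d _; rewrite mulr_gt0 ?powR_gt0. Qed.

Lemma weightB_gt0 w : 0 < weightB w.
Proof. by rewrite prodr_gt0 // => d _; rewrite mulr_gt0 ?powR_gt0. Qed.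

Lemma powR_prod (I : Type) (v : seq I) (c : I -> R) e : (forall i, 0 < c i) ->
  (\prod_(i <- v) c i) `^ e = \prod_(i <- v) c i `^ e.
Proof.
move=> c0; elim: v => [|i v IH]; first by rewrite !big_nil powR1.
by rewrite !big_cons powRM ?IH ?ltW // prodr_gt0.
Qed.

Lemma weightAE w : weightA w = width w `^ alpha1 * height w `^ alpha2.
Proof. by rewrite /width /height !powR_prod // !big_map -big_split. Qed.

Lemma weightBE w : weightB w = width w `^ beta2 * height w `^ beta1.
Proof. by rewrite mulrC /width /height !powR_prod // !big_map -big_split. Qed.

Let cyl w := word_map f w @` L.

Let cyl_sub w : {subset w <= D} -> cyl w `<=` L.
Proof. by move=> wD _ [z Lz <-]; apply: (word_map_in hL). Qed.

Let word_map_sub w x y :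
  ((word_map f w x).1 - (word_map f w y).1 = width w * (x.1 - y.1)) *
  ((word_map f w x).2 - (word_map f w y).2 = height w * (x.2 - y.2)).
Proof. by rewrite !word_mapE /= !iword_sub. Qed.

Lemma near_corner_word w d e z p : near_corner (d / width w) (e / height w) z p ->
  near_corner d e (word_map f w z) (word_map f w p).
Proof.
move=> /andP[w1 w2]; rewrite /near_corner !word_map_sub !normrM.
rewrite (gtr0_norm (width_gt0 w)) (gtr0_norm (height_gt0 w)).
rewrite (mulrC (width w)) (mulrC (height w)).
by rewrite -!ler_pdivlMr ?width_gt0 ?height_gt0 // w1.
Qed.

Lemma covered_cylinder w d e n : covered L (d / width w) (e / height w) n ->
  covered (cyl w) d e n.
Proof.
move=> [l ln hl]; exists (map (word_map f w) l); first by rewrite size_map.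
move=> _ [z /hl[p pl zp] <-]; exists (word_map f w p); first exact: map_f.
exact: near_corner_word.
Qed.

(** This turns harmonic functions at the rescaled sides into a power of [d] times the Bernoulli
    weight of the word. *)
Lemma hfun_cylinder e e' w d : 0 < d ->
  hfun e e' (d / width w) (d / height w) =
  d `^ (- (e + e')) * (width w `^ e * height w `^ e').
Proof.
move=> d0; rewrite hfun_div ?width_gt0 ?height_gt0 //.
by rewrite /hfun -powRDr // opprD.
Qed.

Let setup : exists m rho, [/\ 0 < m, m <= 1, rho < 1,
  forall i, m <= a i <= rho & forall j, m <= b j <= rho].
Proof.
have [m [rho [m0 rho1 am bm]]] := slope_bounds hat hbu.
exists m, rho; split=> //; have /finset.set0Pn[d _] := D_neq0.
by have /andP[h1 h2] := am d.1; lra.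
Qed.

Let L_sub := attractor_sub hat hbu hL.
Let L_neq0 : L !=set0. Proof. by have [] := hL. Qed.

Let covers : exists2 K, 0 < K & forall w d, 0 < d <= Num.min (width w) (height w) ->
  exists n, covered (cyl w) (d / 8) (d / 8) n /\
    n%:R <= K * (d `^ (- (alpha1 + alpha2)) * weightA w
               + d `^ (- (beta1 + beta2)) * weightB w).
Proof.
have [m [rho [m0 m1 rho1 am bm]]] := setup.
have [K K0 hK] := carpet_covered m0 rho1 am bm L_sub (attractor_split hL) ha1 ha2 hb1 hb2.
(* Compensates for the side [d / 8] required by [packing_size_le]. *)
pose k8 e : R := 8 `^ e.
have k80 e : 0 < k8 e by rewrite powR_gt0.
exists (K * (k8 (alpha1 + alpha2) + k8 (beta1 + beta2))).
  by rewrite mulr_gt0 ?addr_gt0.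
move=> w d /andP[d0]; rewrite le_min => /andP[dw dh].
have small c : 0 < c -> d <= c -> 0 < d / 8 / c <= m^-1.
  move=> c0 dc; rewrite !divr_gt0 //= ler_pdivrMr // (mulrC m^-1) ler_pdivlMr //.
  have : d / 8 <= d by lra.
  nra.
have [n [Cn hn]] := hK _ _ (small _ (width_gt0 w) dw) (small _ (height_gt0 w) dh).
exists n; split; first exact: covered_cylinder.
apply: (le_trans hn); have d80 : 0 < d / 8 by lra.
rewrite !hfun_cylinder // -weightAE -weightBE [beta2 + _]addrC !powR_div // -/(k8 _) -/(k8 (beta1 + _)).
rewrite -[leRHS]mulrA ler_pM2l //.
have hA : 0 < d `^ (- (alpha1 + alpha2)) * weightA w by rewrite mulr_gt0 ?powR_gt0 ?weightA_gt0.
have hB : 0 < d `^ (- (beta1 + beta2)) * weightB w by rewrite mulr_gt0 ?powR_gt0 ?weightB_gt0.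
have kA := k80 (alpha1 + alpha2); have kB := k80 (beta1 + beta2).
rewrite (mulrAC _ (k8 _)) (mulrAC _ (k8 (beta1 + _))).
nra.
Qed.

Lemma packing_cylinder_le : exists2 K, 0 < K &
  forall w d, {subset w <= D} -> 0 < d <= Num.min (width w) (height w) ->
    packing_number L d (cyl w) <= K * (d `^ (- (alpha1 + alpha2)) * weightA w
               + d `^ (- (beta1 + beta2)) * weightB w).
Proof.
have [K K0 hK] := covers; exists K => // w d wD hd.
have [n [Cn hn]] := hK w d hd; apply: le_trans hn.
by have /andP[d0 _] := hd; apply: packing_number_le => //; exact: cyl_sub.
Qed.

Let packing_spread m : 0 < m -> exists2 k : R, 0 < k & forall w d n,
  {subset w <= D} -> 0 < d <= Num.min (width w) (height w) ->
  spread m L (d / width w) (d / height w) n ->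
  k * n%:R <= packing_number L d (cyl w).
Proof.
(* The modulus exceeds [1 + 4 / m], as [packing_ge] requires. *)
move=> m0; pose K := (Num.truncn (4 / m)).+2.
have hK : 4 <= (K%:R - 1) * m.
  rewrite -ler_pdivrMr // /K -[X in X - 1]natr1 addrK ltW //.
  exact: truncnS_gt.
have K0 : 0 < (K%:R : R) ^+ 2 by rewrite exprn_gt0 // ltr0n.
exists (K%:R ^+ 2)^-1; first by rewrite invr_gt0.
move=> w d n wD hd [l [<- hl pl]]; have /andP[d0 _] := hd.
rewrite mulrC ler_pdivrMr // mulrC.
have [K' _ hC] := covers; have [n' [Cn' _]] := hC w d hd.
pose g := word_map f w.
rewrite -(size_map (fun e => (g e.1, g e.2))).
apply: (packing_number_ge (cyl_sub wD) Cn' m0 d0 hK).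
  move=> _ /mapP[e /hl[Le ne _] ->] /=; split; first by exists e.1.
  exact: near_corner_word.
rewrite pairwise_map; apply: sub_pairwise pl => e e' /=; rewrite /apart !word_map_sub !normrM.
rewrite (gtr0_norm (width_gt0 w)) (gtr0_norm (height_gt0 w)) !mulrA.
by rewrite !ler_pdivrMr ?width_gt0 ?height_gt0 // ![`|_| * _]mulrC.
Qed.

Lemma packing_cylinder_ge_balanced :
  (forall d, d \in D -> a d.1 `^ alpha1 * b d.2 `^ alpha2 =
                         b d.2 `^ beta1 * a d.1 `^ beta2) ->
  beta1 + beta2 = alpha1 + alpha2 ->
  exists2 c, 0 < c & forall w d, {subset w <= D} ->
    0 < d <= Num.min (width w) (height w) ->
    c * (d `^ (- (alpha1 + alpha2)) * weightA w) <= packing_number L d (cyl w).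
Proof.
move=> pq ab; have [m [rho [m0 m1 rho1 am bm]]] := setup.
have [k k0 hk] := packing_spread m0.
have [K K0 hK] := carpet_spread_balanced m0 rho1 am bm
  (interval_shift_ge0 hat) (interval_end_le1 hat) (interval_shift_ge0 hbu)
  (interval_end_le1 hbu) (interval_sep hat) (interval_sep hbu) L_sub L_neq0
  (attractor_map hL) ha1 ha2 hb1 pq.
exists (k * K); first exact: mulr_gt0.
move=> w d wD hd; have /andP[d0] := hd; rewrite le_min => /andP[dw dh].
have small c : 0 < c -> d <= c -> 0 < d / c <= m^-1.
  move=> c0 dc; rewrite divr_gt0 //= ler_pdivrMr // (mulrC m^-1) ler_pdivlMr //; nra.
have wAB : weightA w = weightB w by apply: eq_big_seq => e /wD; exact: pq.
have [|n [Fn hn]] := hK _ _ (small _ (width_gt0 w) dw) (small _ (height_gt0 w) dh).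
  by rewrite !hfun_cylinder // -weightAE -weightBE wAB [beta2 + _]addrC ab.
apply: le_trans (hk w d n wD hd Fn); rewrite -mulrA ler_pM2l //.
by move: hn; rewrite hfun_cylinder // -weightAE.
Qed.

(** If neither form of drift is available, then [alpha = beta] and the weights agree, which is the
    balanced case. The threshold [d1] depends on the word, the constant [c] does not. *)
Lemma packing_cylinder_ge_columns : beta1 + beta2 <= alpha1 + alpha2 ->
  exists2 c, 0 < c & forall w, {subset w <= D} -> exists2 d1, 0 < d1 &
    forall d, 0 < d <= d1 ->
    c * (d `^ (- (alpha1 + alpha2)) * weightA w) <= packing_number L d (cyl w).
Proof.
move=> ab; have [hab|nab] := pselect (beta1 + beta2 < alpha1 + alpha2 \/
    beta1 + beta2 = alpha1 + alpha2 /\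
    (exists2 d, d \in D & a d.1 `^ alpha1 * b d.2 `^ alpha2 !=
                           b d.2 `^ beta1 * a d.1 `^ beta2)); last first.
  have e : beta1 + beta2 = alpha1 + alpha2.
    by apply/eqP; rewrite eq_le ab leNgt; apply/negP => lt; apply: nab; left.
  have [d dD|c c0 hc] := packing_cylinder_ge_balanced _ e.
    by apply: contrapT => /eqP ne; apply: nab; right; split=> //; exists d.
  exists c => // w wD; exists (Num.min (width w) (height w)).
    by rewrite lt_min width_gt0 height_gt0.
  by move=> d; exact: hc.
have [m [rho [m0 m1 rho1 am bm]]] := setup.
have [k k0 hk] := packing_spread m0.
have [K K0 hK] := carpet_spread_columns m0 rho1 am bm
  (interval_shift_ge0 hat) (interval_end_le1 hat) (interval_shift_ge0 hbu)
  (interval_end_le1 hbu) (interval_sep hat) (interval_sep hbu) D_neq0 L_sub L_neq0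
  (attractor_map hL) ha1 ha2 hb1 hb2 hab.
exists (k * K); first exact: mulr_gt0.
move=> w wD; have w0 := width_gt0 w; have h0 := height_gt0 w.
(* The ratio of the rescaled sides [d / width w] and [d / height w] does not depend on [d]. *)
have [e e0 he] := hK (height w / width w) (divr_gt0 h0 w0).
exists (Num.min (Num.min (width w) (height w)) (Num.min (e * width w) (e * height w))).
  by rewrite !lt_min w0 h0 !mulr_gt0.
move=> d /andP[d0]; rewrite le_min => /andP[hd]; rewrite le_min => /andP[dw dh].
have [|||n [Fn hn]] := he (d / width w) (d / height w).
- by rewrite divr_gt0 //= ler_pdivrMr.
- by rewrite divr_gt0 //= ler_pdivrMr.
- by field; rewrite !gt_eqF.
have hd' : 0 < d <= Num.min (width w) (height w) by rewrite d0.
apply: le_trans (hk w d n wD hd' Fn); rewrite -mulrA ler_pM2l //.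
by move: hn; rewrite hfun_cylinder // -weightAE.
Qed.

Lemma packing_cylinder_ge_rows : alpha1 + alpha2 <= beta1 + beta2 ->
  exists2 c, 0 < c & forall w, {subset w <= D} -> exists2 d1, 0 < d1 &
    forall d, 0 < d <= d1 ->
    c * (d `^ (- (beta1 + beta2)) * weightB w) <= packing_number L d (cyl w).
Proof.
move=> ab; have [hab|nab] := pselect (alpha1 + alpha2 < beta1 + beta2 \/
    alpha1 + alpha2 = beta1 + beta2 /\
    (exists2 d, d \in D & b d.2 `^ beta1 * a d.1 `^ beta2 !=
                           a d.1 `^ alpha1 * b d.2 `^ alpha2)); last first.
  have e : beta1 + beta2 = alpha1 + alpha2.
    by apply/esym/eqP; rewrite eq_le ab leNgt; apply/negP => lt; apply: nab; left.
  have pq d : d \in D -> a d.1 `^ alpha1 * b d.2 `^ alpha2 =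
                         b d.2 `^ beta1 * a d.1 `^ beta2.
    move=> dD; apply: contrapT => /eqP ne; apply: nab; right; split=> //.
    by exists d; rewrite // eq_sym.
  have [c c0 hc] := packing_cylinder_ge_balanced pq e.
  exists c => // w wD; exists (Num.min (width w) (height w)).
    by rewrite lt_min width_gt0 height_gt0.
  move=> d hd; have := hc w d wD hd; rewrite -e.
  by rewrite (_ : weightA w = weightB w) //; apply: eq_big_seq => i /wD; exact: pq.
have [m [rho [m0 m1 rho1 am bm]]] := setup.
have [k k0 hk] := packing_spread m0.
have [K K0 hK] := carpet_spread_rows m0 rho1 am bm
  (interval_shift_ge0 hat) (interval_end_le1 hat) (interval_shift_ge0 hbu)
  (interval_end_le1 hbu) (interval_sep hat) (interval_sep hbu) D_neq0 L_sub L_neq0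
  (attractor_map hL) ha1 ha2 hb1 hb2 hab.
exists (k * K); first exact: mulr_gt0.
move=> w wD; have w0 := width_gt0 w; have h0 := height_gt0 w.
have [e e0 he] := hK (width w / height w) (divr_gt0 w0 h0).
exists (Num.min (Num.min (width w) (height w)) (Num.min (e * width w) (e * height w))).
  by rewrite !lt_min w0 h0 !mulr_gt0.
move=> d /andP[d0]; rewrite le_min => /andP[hd]; rewrite le_min => /andP[dw dh].
have [|||n [Fn hn]] := he (d / width w) (d / height w).
- by rewrite divr_gt0 //= ler_pdivrMr.
- by rewrite divr_gt0 //= ler_pdivrMr.
- by field; rewrite !gt_eqF.
have hd' : 0 < d <= Num.min (width w) (height w) by rewrite d0.
apply: le_trans (hk w d n wD hd' Fn); rewrite -mulrA ler_pM2l //.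
by move: hn; rewrite hfun_cylinder // -weightBE [beta2 + _]addrC.
Qed.

End cylinder_counting.

(** * From cylinder counts to the box-counting property *)

Lemma box_counting_criterion {R : realType} (r s : nat) (a t : 'I_r -> R)
    (b u : 'I_s -> R) (D : {set 'I_r * 'I_s}) (L : set (plane R))
    (mu : {measure set (borel (plane R)) -> \bar R}) (W : seq ('I_r * 'I_s) -> R)
    (gamma c C : R) :
  vitali_covering L (cylinders (baranski_map a t b u) D L) ->
  finite_borel_measure_on L mu ->
  (forall w, {subset w <= D} -> mu (word_map (baranski_map a t b u) w @` L) = (W w)%:E) ->
  (forall w, 0 < W w) -> 0 < c -> 0 < C ->
  (forall w, {subset w <= D} -> exists2 d0, 0 < d0 & forall d, 0 < d <= d0 ->
    c * W w <= packing_number L d (word_map (baranski_map a t b u) w @` L) * d `^ gamma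
      <= C * W w) ->
  cylinder_box_counting_measure (baranski_map a t b u) D L mu.
Proof.
move=> vit fin muW W0 c0 C0 H; split=> //; split=> //; exists gamma; split.
  (* The empty word gives the whole carpet, hence the box dimension. *)
  have [|d0 d00 hd] := H [::]; first by [].
  rewrite /word_map /= image_id in hd.
  apply: (cvg_log_ratio _ d00 hd); exact: mulr_gt0.
exists (Num.max c^-1 C); split; first by rewrite lt_max C0 orbT.
move=> k A _ [w [_ wD] <-]; have [d0 d00 hd] := H w wD; exists d0; split=> // d /hd.
rewrite (muW w wD) -!EFinM !lee_fin => /andP[h1 h2]; have Ww := W0 w.
apply/andP; split.
  apply: le_trans h1; rewrite ler_pM2r //.
  by rewrite -[leRHS]invrK lef_pV2 ?posrE ?lt_max ?invr_gt0 ?c0 // le_max lexx.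
by apply: (le_trans h2); rewrite ler_pM2r // le_max lexx orbT.
Qed.

Theorem theorem1p5 (R : realType) (r s : nat)
    (a t : 'I_r -> R) (b u : 'I_s -> R) (D : {set 'I_r * 'I_s})
    (L : set (plane R)) (alpha1 alpha2 beta1 beta2 : R)
    (muA muB : probability (borel (plane R)) R) :
  (2 <= r)%N -> (2 <= s)%N ->
  interval_contractions a t -> interval_contractions b u ->
  D != finset.set0 ->
  attractor (baranski_map a t b u) D L ->
  \sum_(i in [set d.1 | d in D]%SET) a i `^ alpha1 = 1 ->
  \sum_(d in D) a d.1 `^ alpha1 * b d.2 `^ alpha2 = 1 ->
  \sum_(j in [set d.2 | d in D]%SET) b j `^ beta1 = 1 ->
  \sum_(d in D) b d.2 `^ beta1 * a d.1 `^ beta2 = 1 ->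
  bernoulli_measure (baranski_map a t b u) D L
    (fun d => a d.1 `^ alpha1 * b d.2 `^ alpha2) muA ->
  bernoulli_measure (baranski_map a t b u) D L
    (fun d => b d.2 `^ beta1 * a d.1 `^ beta2) muB ->
  cylinder_box_counting_measure (baranski_map a t b u) D L
    (carpet_measure (alpha1 + alpha2) (beta1 + beta2) muA muB).
Proof.
move=> _ _ hat hbu D0 hL ha1 ha2 hb1 hb2 hmuA hmuB.
have a0 i : 0 < a i by have /andP[] := interval_slope hat i.
have b0 j : 0 < b j by have /andP[] := interval_slope hbu j.
have vit := carpet_vitali_covering hat hbu D0 hL.
have [K K0 hU] := packing_cylinder_le hat hbu D0 hL ha1 ha2 hb1 hb2.
have cylA w : {subset w <= D} -> muA (word_map (baranski_map a t b u) w @` L) =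
    (weightA a b alpha1 alpha2 w)%:E.
  apply: (bernoulli_cylinder hat hbu hL hmuA _ ha2) => d _.
  by rewrite mulr_gt0 ?powR_gt0.
have cylB w : {subset w <= D} -> muB (word_map (baranski_map a t b u) w @` L) =
    (weightB a b beta1 beta2 w)%:E.
  apply: (bernoulli_cylinder hat hbu hL hmuB _ hb2) => d _.
  by rewrite mulr_gt0 ?powR_gt0.
have L_closed : closed L.
  by have [_ Lc _] := hL; apply: compact_closed => //; exact: metric_hausdorff.
have nullA := bernoulli_setC hmuA L_closed; have nullB := bernoulli_setC hmuB L_closed.
have wA := @weightA_gt0 R r s a t b u alpha1 alpha2 hat hbu.
have wB := @weightB_gt0 R r s a t b u beta1 beta2 hat hbu.
have min0 w : 0 < Num.min (width a w) (height b w).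
  by rewrite lt_min (width_gt0 hat) (height_gt0 hbu).
have finP (mu : probability (borel (plane R)) R) : mu (~` L) = 0%E ->
  finite_borel_measure_on L mu.
  by move=> h; split=> // A mA; exact: fin_num_measure.
rewrite /carpet_measure.
have [ba|ab] := ltP (beta1 + beta2) (alpha1 + alpha2).
  have [c c0 hc] := packing_cylinder_ge_columns hat hbu D0 hL ha1 ha2 hb1 hb2 (ltW ba).
  apply: (box_counting_criterion (gamma := alpha1 + alpha2) (C := 2 * K)
    vit (finP _ nullA) cylA wA c0) => [|w wD]; first exact: mulr_gt0.
  have [d1 d10 hd1] := hc w wD.
  (* The upper bound contains both terms; for small [d] the one with the smaller exponent is
     absorbed into the other, at the cost of the factor 2. *)
  apply: (@dominant_bounds R _ _
    (fun d => packing_number L d (word_map (baranski_map a t b u) w @` L)) _ _ _ _ (Num.min d1 (Num.min (width a w) (height b w))) ba (wA w) (wB w) K0).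
  - by rewrite lt_min d10 min0.
  - move=> d /andP[d0]; rewrite le_min => /andP[_ dm]; apply: hU => //; by rewrite d0.
  - by move=> d /andP[d0]; rewrite le_min => /andP[dm _]; apply: hd1; rewrite d0.
have [ab'|ba] := ltP (alpha1 + alpha2) (beta1 + beta2).
  have [c c0 hc] := packing_cylinder_ge_rows hat hbu D0 hL ha1 ha2 hb1 hb2 ab.
  apply: (box_counting_criterion (gamma := beta1 + beta2) (C := 2 * K)
    vit (finP _ nullB) cylB wB c0) => [|w wD]; first exact: mulr_gt0.
  have [d1 d10 hd1] := hc w wD.
  apply: (@dominant_bounds R _ _
    (fun d => packing_number L d (word_map (baranski_map a t b u) w @` L)) _ _ _ _ (Num.min d1 (Num.min (width a w) (height b w))) ab' (wB w) (wA w) K0).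
  - by rewrite lt_min d10 min0.
  - move=> d /andP[d0]; rewrite le_min => /andP[_ dm]; rewrite addrC; apply: hU => //; by rewrite d0.
  - by move=> d /andP[d0]; rewrite le_min => /andP[dm _]; apply: hd1; rewrite d0.
have e : alpha1 + alpha2 = beta1 + beta2 by apply/eqP; rewrite eq_le ab ba.
have [c c0 hc] := packing_cylinder_ge_columns hat hbu D0 hL ha1 ha2 hb1 hb2 ba.
have [c' c'0 hc'] := packing_cylinder_ge_rows hat hbu D0 hL ha1 ha2 hb1 hb2 ab.
have addE (A : set (borel (plane R))) :
    (measure_add muA muB : {measure set (borel (plane R)) -> \bar R}) A =
    (muA A + muB A)%E.
  exact: measure_addE.
(* Both lower bounds hold with the same power of [d]; their average bounds the count below by a
   multiple of the sum of the two weights. *)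
pose c2 := Num.min c c' / 2.
have c20 : 0 < c2 by rewrite divr_gt0 // lt_min c0.
apply: (box_counting_criterion (gamma := alpha1 + alpha2)
  (W := fun w => weightA a b alpha1 alpha2 w + weightB a b beta1 beta2 w)
  vit _ _ _ c20 K0) => [|w wD|w|w wD].
- split.
    move=> A mA; rewrite addE fin_numD.
    by apply/andP; split; apply: fin_num_measure.
  by rewrite addE nullA nullB adde0.
- by rewrite addE cylA // cylB.
- by rewrite addr_gt0.
have [d1 d10 hd1] := hc w wD; have [d2 d20 hd2] := hc' w wD.
exists (Num.min (Num.min d1 d2) (Num.min (width a w) (height b w))).
  by rewrite !lt_min d10 d20 /= -lt_min min0.
move=> d /andP[d0]; rewrite !le_min -!andbA => /and4P[dd1 dd2 dw dh].
have p1 : 0 < d `^ (alpha1 + alpha2) by apply: powR_gt0.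
have inv : d `^ (- (alpha1 + alpha2)) * d `^ (alpha1 + alpha2) = 1.
  by rewrite -powRDr // addNr powRr0.
have := hU w d wD; rewrite d0 le_min dw dh => /(_ isT).
have := hd1 d; rewrite d0 dd1 => /(_ isT); have := hd2 d; rewrite d0 dd2 => /(_ isT).
rewrite -e -![_ <= packing_number _ _ _](ler_pM2r p1)
  -[packing_number _ _ _ <= _](ler_pM2r p1).
set N := packing_number _ _ _ * _; set wa := weightA _ _ _ _ _; set wb := weightB _ _ _ _ _.
set X := d `^ (- _) in inv *; set Y := d `^ _ in inv *.
have wa0 : 0 < wa by apply: wA.
have wb0 : 0 < wb by apply: wB.
have c1 : c2 * 2 <= c by rewrite /c2 divfK // ge_min lexx.
have c1' : c2 * 2 <= c' by rewrite /c2 divfK // ge_min lexx orbT.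
rewrite (_ : c' * _ * _ = c' * wb * (X * Y)); last ring.
rewrite (_ : c * _ * _ = c * wa * (X * Y)); last ring.
rewrite (_ : K * _ * _ = K * (wa + wb) * (X * Y)); last ring.
rewrite inv !mulr1 => h1 h2 h3; rewrite h3 andbT.
nra.
Qed.
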